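(* For each $m\in\mathbb{N}$ there exist constants $C_m,C'_m>0$ such that the following holds: let $H$ be a seminorming graph each of whose non-singleton connected components (which are all isomorphic) has exactly $m$ edges. Then the Banach space $(\mathcal{W}_H,\|\cdot\|_H)$ satisfies $C_m\cdot\mathfrak{d}_{\ell^m}\le\mathfrak{d}_H\le\mathfrak{d}_{\ell^m}$ and $\mathfrak{s}_{\ell^m}\le\mathfrak{s}_H\le C'_m\cdot\mathfrak{s}_{\ell^m}$ (as functions of $\varepsilon$).
   Context: Graphs are finite and simple. Let $\Omega$ be a standard Borel space with an atomless probability measure $\nu$. For a graph $H$ on vertex set $\{v_1,\dots,v_n\}$ and a symmetric measurable $W:\Omega^2\to\mathbb{R}$, $t(H,W):=\int_{\Omega^n}\prod_{\{v_i,v_j\}\in E(H)}W(x_i,x_j)\,d\nu^{\otimes n}$. Let $\mathcal{W}_H$ be the set of symmetric measurable $W$ for which $|t(H,W)|$ is defined and finite; $H$ is seminorming if $\|W\|_H:=|t(H,W)|^{1/e(H)}$ is a seminorm on $\mathcal{W}_H$. For a normed space $(X,\|\cdot\|)$, $\mathfrak{d}_X(\varepsilon):=\inf\{1-\|\tfrac{x+y}{2}\| : x,y\in X,\ \|x-y\|\ge\varepsilon,\ \|x\|=\|y\|=1\}$ for $\varepsilon\in(0,2]$ and $\mathfrak{s}_X(\varepsilon):=\sup\{\tfrac12(\|x+y\|+\|x-y\|-2): x,y\in X,\ \|x\|=1,\ \|y\|=\varepsilon\}$ for $\varepsilon>0$. $\mathfrak{d}_H,\mathfrak{s}_H$ denote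 these moduli for $(\mathcal{W}_H,\|\cdot\|_H)$, and $\mathfrak{d}_{\ell^m},\mathfrak{s}_{\ell^m}$ those for the sequence space $\ell^m$ with its usual norm $\|\mathbf{a}\|_m=(\sum_i|a_i|^m)^{1/m}$.
   Formalization: For m=1 the bounds d_H ≤ d_{ℓ^1} and s_{ℓ^1} ≤ s_H are not claimed, since they fail (H=K_2: ‖W‖_H=|∫W|, d_H=1>0=d_{ℓ^1}, s_H(ε)=max(0,ε−1)<ε); the other two bounds are kept for m=1. Completeness of W_H (''Banach'') is not asserted; it fails for C_4. *)

(* Defs.v *)
From HB Require Import structures.
From mathcomp Require Import all_boot all_order all_algebra.
From mathcomp Require Import all_classical all_reals all_analysis.

Set Implicit Arguments.
Unset Strict Implicit.
Unset Printing Implicit Defensive.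
Import Order.TTheory GRing.Theory Num.Theory.
Import numFieldNormedType.Exports.
Local Open Scope classical_set_scope.
Local Open Scope ring_scope.

(* Vectors of seminorm 0 are not quotiented out: [N] is only evaluated at linear
   combinations of the arguments, so both moduli agree with those of the normed
   space obtained by quotienting [V] by the kernel of [N].  They are taken in
   [\bar R], so that no convention for unbounded or empty sets intervenes. *)
Section moduli.
Context {R : realType} {U : lmodType R}.
Implicit Types (V : set U) (N : U -> R).

Definition is_subspace V : Prop :=
  [/\ V 0, (forall x y, V x -> V y -> V (x + y)) &
      (forall (k : R) x, V x -> V (k *: x))].

Definition is_seminorm V N : Prop :=
  [/\ is_subspace V, (forall x, V x -> 0 <= N x),
      (forall (k : R) x, V x -> N (k *: x) = `|k| * N x) &
      (forall x y, V x -> V y -> N (x + y) <= N x + N y)].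

Definition modulus_convexity V N (eps : R) : \bar R :=
  ereal_inf [set (1 - N (2^-1 *: (xy.1 + xy.2)))%:E | xy in
    [set xy : U * U | [/\ V xy.1, V xy.2, eps <= N (xy.1 - xy.2),
                          N xy.1 = 1 & N xy.2 = 1]]].

Definition modulus_smoothness V N (eps : R) : \bar R :=
  ereal_sup [set (2^-1 * (N (xy.1 + xy.2) + N (xy.1 - xy.2) - 2))%:E | xy in
    [set xy : U * U | [/\ V xy.1, V xy.2, N xy.1 = 1 & N xy.2 = eps]]].

End moduli.

Definition lseq {R : realType} (m : nat) : set (nat -> R) :=
  [set a : nat -> R | cvgn (series (fun i => `|a i| ^+ m : R))].

Definition lnorm {R : realType} (m : nat) (a : nat -> R) : R :=
  limn (series (fun i => `|a i| ^+ m : R)) `^ m%:R^-1.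

(* [X] is a Polish space whose Borel sigma-algebra is carried to that of [T]. *)
Definition standard_borel (R : realType) d (T : measurableType d) : Prop :=
  exists (X : metricType R) (f : T -> X),
    [/\ (forall F : set_system X, ProperFilter F -> cauchy F ->
           exists x : X, F --> x),
        (exists2 D : set X, countable D & dense D),
        set_bij [set: T] [set: X] f &
        forall A : set T, measurable A <-> <<s @open X >> (f @` A)].

Definition atomless (R : realType) d (T : measurableType d)
    (mu : set T -> \bar R) : Prop :=
  forall A, measurable A -> (0 < mu A)%E ->
    exists2 B, measurable B & B `<=` A /\ (0 < mu B < mu A)%E.

Section power_measure.
Context {R : realType} {d : measure_display} {T : measurableType d}.
Variable nu : probability T R.

Definition tcons n (x : T * n.-tuple T) : n.+1.-tuple T :=
  [the n.+1.-tuple T of x.1 :: x.2].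

Lemma measurable_tcons n : measurable_fun [set: T * n.-tuple T] (@tcons n).
Proof. exact: measurable_cons. Qed.

HB.instance Definition _ n :=
  isMeasurableFun.Build _ _ _ _ (@tcons n) (@measurable_tcons n).

Fixpoint power_measure (n : nat) : probability (n.-tuple T) R :=
  match n with
  | 0 => \d_ ([tuple] : 0.-tuple T)
  | n'.+1 => distribution (nu \x power_measure n')%E (@tcons n')
  end.

Lemma power_measure_box n (A : 'I_n -> set T) :
  (forall i, measurable (A i)) ->
  power_measure n [set x | forall i, A i (tnth x i)] = (\prod_(i < n) nu (A i))%E.
Proof.
elim: n A => [|n IHn] A mA.
  rewrite /= big_ord0 diracE mem_set//= => i.
  by have := ltn_ord i; rewrite ltn0.
pose B : set (n.-tuple T) := [set x | forall i, A (lift ord0 i) (tnth x i)].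
have mB : measurable B.
  rewrite (_ : B = \bigcap_(i in [set: 'I_n])
      (@tnth n T ^~ i) @^-1` A (lift ord0 i)); last first.
    by apply/seteqP; split => [x Bx i _|x Bx i]; [exact: Bx|exact: Bx].
  apply: fin_bigcap_measurable => //= i _.
  by rewrite -[X in measurable X]setTI; exact: measurable_tnth.
rewrite big_ord_recl /= -IHn; last by move=> i; exact: mA.
rewrite -product_measure1E //; congr (_ _).
apply/seteqP; split => [[x t] /= Hx|[x t] /= [Ax Bt] i].
  split; first by have := Hx ord0.
  by move=> i; have := Hx (lift ord0 i); rewrite tnthS.
by case: (unliftP ord0 i) => [j|] ->; rewrite ?tnthS.
Qed.

End power_measure.

(* A simple graph on ['I_n] is a symmetric irreflexive [E : rel 'I_n]; an
   unordered edge is represented by its endpoints in increasing order. *)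
Definition edges n (E : rel 'I_n) : {set 'I_n * 'I_n} :=
  [set p : 'I_n * 'I_n | (p.1 < p.2)%N && E p.1 p.2].

Definition component n (E : rel 'I_n) (v : 'I_n) : {set 'I_n} :=
  [set u | connect E v u].

Definition edges_in n (E : rel 'I_n) (C : {set 'I_n}) : {set 'I_n * 'I_n} :=
  [set p in edges E | (p.1 \in C) && (p.2 \in C)].

Section graph_norm.
Context {R : realType} {d : measure_display} {T : measurableType d}.
Variable nu : probability T R.
Context {n : nat}.
Variable E : rel 'I_n.

Definition hom_integrand (W : T * T -> R) (x : n.-tuple T) : R :=
  \prod_(p in edges E) W (tnth x p.1, tnth x p.2).

Definition hom_density (W : T * T -> R) : R :=
  \int[power_measure nu n]_x hom_integrand W x.

(* [|t(H,W)|] is defined and finite iff the integrand is integrable. *)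
Definition kernel_space : set (T * T -> R) :=
  [set W | [/\ measurable_fun [set: T * T] W, (forall x y, W (x, y) = W (y, x)) &
    (power_measure nu n).-integrable [set: n.-tuple T]
      (EFin \o hom_integrand W)]].

Definition graph_norm (W : T * T -> R) : R :=
  `|hom_density W| `^ #|edges E|%:R^-1.

(* An edgeless graph is never seminorming: [0^-1 = 0] and [a `^ 0 = 1], so its
   [graph_norm] is constantly 1.  A perfect matching is seminorming, with norm
   [W |-> `|\int W|] of one-dimensional quotient; its moduli are those of the
   real line, and not bounded by those of l^1 in the way that holds for
   components with at least two edges. *)
Definition seminorming : Prop := is_seminorm kernel_space graph_norm.

End graph_norm.

(* Main.v *)
Require Import Defs.
From HB Require Import structures.
From mathcomp Require Import all_boot all_order all_algebra.
From mathcomp Require Import all_classical all_reals all_analysis.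
From mathcomp Require Import measurable_realfun ring lra.
Set Implicit Arguments.
Unset Strict Implicit.
Unset Printing Implicit Defensive.
Import Order.TTheory GRing.Theory Num.Theory.
Import numFieldNormedType.Exports.
Local Open Scope classical_set_scope.
Local Open Scope ring_scope.

(** A seminorming graph satisfies a Hoelder inequality for edge-decorated
    densities (tensor-power trick).  Decorating one component with [W] and the
    rest with [1], and conversely, forces [|t(component, W)| = ||W||^m], so
    Hoelder for a single component with [m] edges bounds all mixed terms of
    [t(component, x + y)] and [t(component, x - y)].  For even [m] this is
    Hanner's inequality
    [||x+y||^m + ||x-y||^m <= (||x||+||y||)^m + (||x||-||y||)^m];
    odd [m >= 3] is excluded by diagonal kernels.  Since [W_H] contains
    isometric copies of the spaces [l^m_k], Hanner's inequality determines both
    moduli, which are therefore equal to those of [l^m] when [m >= 2]; for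
    [m = 1] the moduli of [l^1] are the trivial bounds.

    The Hoelder inequality is proved for step kernels, where tensor powers can
    be realised because an atomless measure admits partitions with arbitrary
    weights; Hanner's inequality is then extended to [W_H] by approximation. *)

(** * Densities of graphs in finite weighted kernels *)

(** The graph norm has exponent e(H), while the moduli are those of l^m. Expanding t(H, x + y) over
    all edges would only lead to Hanner's inequality with exponent e(H), so the expansion has to be
    done on one component. Hanner's inequality is the right target because it is sharp: explicit
    pairs in a copy of l^m_2 attain the bounds it gives for both moduli, and both constants come out
    as 1. Two obstacles shape the rest. A tensor power of a kernel lives on a power of Omega, where
    nothing is assumed about the norm; over finite weighted label sets a product is again a finite
    weighted label set, hence is again realised on Omega. And L1 closeness does not control
    densities of unbounded kernels. Here it helps that seminorming includes W_H being a subspace: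
    |x| + |y| lies in W_H, and its integrand dominates those of all truncations of x, y, x + y and x
    - y. *)

Section discrete_density.
Context {R : realType} {n : nat}.
Implicit Types (I : finType) (K L : {set 'I_n * 'I_n}).

Definition tuple_weight I (p : I -> R) (a : {ffun 'I_n -> I}) : R :=
  \prod_v p (a v).

(** Every edge carries its own kernel, so that mixed terms are densities too. Labellings of all [n]
    vertices are summed even for small [K]; once [p] has total weight 1, vertices off [K] contribute
    a factor 1 and different edge sets can be compared. *)
Definition density I (p : I -> R) K (w : 'I_n * 'I_n -> I -> I -> R) : R :=
  \sum_(a : {ffun 'I_n -> I})
    tuple_weight p a * \prod_(e in K) w e (a e.1) (a e.2).

Lemma eq_density I (p : I -> R) K w w' :
  (forall e x y, e \in K -> w e x y = w' e x y) ->
  density p K w = density p K w'.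
Proof.
move=> ww'; apply: eq_bigr => a _; congr (_ * _).
by apply: eq_bigr => e eK; exact: ww'.
Qed.

Lemma sum_tuple_weight I (p : I -> R) :
  \sum_i p i = 1 -> \sum_a tuple_weight p a = 1.
Proof.
move=> p1; rewrite -(bigA_distr_bigA (fun _ : 'I_n => p)) /=.
by apply: big1.
Qed.

Lemma density1 I (p : I -> R) K :
  \sum_i p i = 1 -> density p K (fun _ _ _ => 1) = 1.
Proof.
move=> p1; transitivity (\sum_a tuple_weight p a); last exact: sum_tuple_weight.
by apply: eq_bigr => a _; rewrite big1 ?mulr1.
Qed.

Lemma densityZ I (p : I -> R) K (c : 'I_n * 'I_n -> R) w :
  density p K (fun e x y => c e * w e x y) =
  (\prod_(e in K) c e) * density p K w.
Proof.
rewrite /density mulr_sumr; apply: eq_bigr => a _.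
by rewrite big_split /= mulrCA.
Qed.

(** Multilinearity in the edges: [pffun_on j0 K A] runs over the choices of one summand per edge of
    [K], and the default [j0] off [K] makes each choice occur once. *)
Lemma density_sum I (p : I -> R) K (J : finType) (j0 : J) (A : {set J})
    (w : 'I_n * 'I_n -> J -> I -> I -> R) :
  density p K (fun e x y => \sum_(j in A) w e j x y) =
  \sum_(f in pffun_on j0 K A) density p K (fun e => w e (f e)).
Proof.
rewrite /density.
under eq_bigr => a _ do rewrite (big_distr_big j0) mulr_sumr.
by rewrite exchange_big.
Qed.

Definition pair_weight I I' (p : I -> R) (p' : I' -> R) (x : I * I') : R :=
  p x.1 * p' x.2.

Lemma sum_pair_weight I I' (p : I -> R) (p' : I' -> R) :
  \sum_i p i = 1 -> \sum_i p' i = 1 -> \sum_x pair_weight p p' x = 1.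
Proof.
move=> p1 p'1; rewrite -(pair_bigA _ (fun i j => p i * p' j)) /=.
by rewrite -big_distrlr /= p1 p'1 mulr1.
Qed.

Lemma density_pair I I' (p : I -> R) (p' : I' -> R) K w w' :
  density (pair_weight p p') K (fun e x y => w e x.1 y.1 * w' e x.2 y.2) =
  density p K w * density p' K w'.
Proof.
rewrite /density big_distrlr /=.
rewrite (pair_bigA _ (fun a b =>
  (tuple_weight p a * \prod_(e in K) w e (a e.1) (a e.2)) *
  (tuple_weight p' b * \prod_(e in K) w' e (b e.1) (b e.2)))) /=.
rewrite (reindex
  (fun ab : {ffun 'I_n -> I} * {ffun 'I_n -> I'} =>
    [ffun v => (ab.1 v, ab.2 v)])) /=.
  apply: eq_bigr => -[a b] _ /=.
  rewrite mulrACA -!big_split /=; congr (_ * _).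
    by apply: eq_bigr => v _; rewrite ffunE.
  by apply: eq_bigr => v _; rewrite !ffunE.
exists (fun c : {ffun 'I_n -> I * I'} =>
    ([ffun v => (c v).1], [ffun v => (c v).2])) => [[a b] _|c _] /=.
  by congr (_, _); apply/ffunP => v; rewrite !ffunE.
by apply/ffunP => v; rewrite !ffunE; case: (c v).
Qed.

(* Two independent copies [a], [b] of the vertex labelling are recombined along
   the vertex set [C]; this exchange preserves the product weight. *)
Lemma density_split I (p : I -> R) K L (C : {set 'I_n}) w :
  \sum_i p i = 1 ->
  (forall e, e \in K -> (e.1 \in C) && (e.2 \in C)) ->
  (forall e, e \in L -> (e.1 \notin C) && (e.2 \notin C)) ->
  density p (K :|: L) w = density p K w * density p L w.
Proof.
move=> p1 KC LC.
have KL0 : fintype.disjoint (mem K) (mem L).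
  rewrite disjoint_subset; apply/fintype.subsetP => e /KC /andP[eC _].
  by rewrite inE; apply: contraTN eC => /LC/andP[].
pose mix (a b : {ffun 'I_n -> I}) : {ffun 'I_n -> I} :=
  [ffun v => if v \in C then a v else b v].
pose sw (ab : {ffun 'I_n -> I} * {ffun 'I_n -> I}) :=
  (mix ab.1 ab.2, mix ab.2 ab.1).
have swK : involutive sw.
  by move=> [a b]; rewrite /sw /=; congr (_, _); apply/ffunP => v;
    rewrite !ffunE; case: (v \in C).
(* A second, idle labelling of total weight 1 supplies the [b] to exchange with. *)
transitivity (\sum_(ab : {ffun 'I_n -> I} * {ffun 'I_n -> I})
    (tuple_weight p ab.1 *
      (\prod_(e in K :|: L) w e (ab.1 e.1) (ab.1 e.2))) *
    tuple_weight p ab.2).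
  rewrite -(pair_bigA _ (fun a b => (tuple_weight p a *
     (\prod_(e in K :|: L) w e (a e.1) (a e.2))) * tuple_weight p b)) /=.
  by rewrite -big_distrlr /= (sum_tuple_weight p1) mulr1.
rewrite (reindex_inj (inv_inj swK)) /=.
rewrite /density big_distrlr /=.
rewrite (pair_bigA _ (fun a b =>
  (tuple_weight p a * \prod_(e in K) w e (a e.1) (a e.2)) *
  (tuple_weight p b * \prod_(e in L) w e (b e.1) (b e.2)))) /=.
apply: eq_bigr => -[a b] _ /=.
have -> : \prod_(e in K :|: L) w e (mix a b e.1) (mix a b e.2) =
   (\prod_(e in K) w e (a e.1) (a e.2)) * (\prod_(e in L) w e (b e.1) (b e.2)).
  rewrite (eq_bigl [in [predU K & L]]) => [|e]; last by rewrite !inE.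
  rewrite bigU//=; congr (_ * _); apply: eq_bigr => e.
    by move=> /KC/andP[e1 e2]; rewrite !ffunE e1 e2.
  by move=> /LC/andP[/negbTE e1 /negbTE e2]; rewrite !ffunE e1 e2.
rewrite mulrAC [RHS]mulrACA; congr (_ * _).
rewrite /tuple_weight -!big_split /=; apply: eq_bigr => v _.
by rewrite !ffunE; case: (v \in C) => //; rewrite mulrC.
Qed.

(** This lets an inequality for the full edge set be applied to a subgraph. *)
Lemma density_sub I (p : I -> R) K L w : K \subset L ->
  density p L (fun e x y => if e \in K then w e x y else 1) = density p K w.
Proof.
move=> KL; apply: eq_bigr => a _; congr (_ * _).
rewrite -big_mkcondr /=; apply: eq_bigl => e.
by rewrite andb_idl//; exact: (fintype.subsetP KL).
Qed.

End discrete_density.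

(** The last move of the tensor-power trick: if x > 1, Bernoulli's inequality makes its powers
    exceed any [B]. *)
Lemma bounded_expr2n_le1 {R : realType} (x B : R) :
  0 <= x -> (forall k, x ^+ (2 ^ k) <= B) -> x <= 1.
Proof.
move=> x0 xB; rewrite leNgt; apply/negP => x1.
have bern k : 1 + (x - 1) *+ k <= x ^+ k.
  elim: k => [|k IH]; first by rewrite mulr0n expr0 addr0.
  rewrite exprS mulrS.
  have : 0 <= (x - 1) ^+ 2 *+ k by rewrite mulrn_wge0// sqr_ge0.
  have := ler_wpM2l x0 IH.
  rewrite -[(x - 1) ^+ 2 *+ k]mulr_natl -[(x - 1) *+ k]mulr_natl; nra.
pose k := (Num.truncn (`|B| / (x - 1))).+1.
have x10 : 0 < x - 1 by rewrite subr_gt0.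
have Bk : `|B| < (x - 1) *+ k.
  by rewrite -mulr_natl -ltr_pdivrMr// truncnS_gt.
have := xB k; apply/negP; rewrite -ltNge (le_lt_trans (ler_norm B))//.
rewrite (lt_le_trans Bk)// (le_trans _ (bern _))//.
rewrite (le_trans (y := (x - 1) *+ (2 ^ k)))//; last by rewrite lerDr.
by apply: ler_wpMn2l; [exact: ltW|exact/ltnW/ltn_expl].
Qed.

(** * Hoelder's inequality by tensor powers *)

Section hoelder.
Context {R : realType} {n : nat} (E : {set 'I_n * 'I_n}).
Hypothesis E_gt0 : (0 < #|E|)%N.

Definition density_norm (I : finType) (p : I -> R) (w : I -> I -> R) : R :=
  `|density p E (fun=> w)| `^ #|E|%:R^-1.

(** Quantified over all finite weighted label sets, because the tensor trick replaces [I] by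
    [I * I]; the index set [J] will be the set of edges or [bool]. *)
Definition subadditive_density_norm : Prop :=
  forall (I : finType) (p : I -> R), (forall i, 0 <= p i) -> \sum_i p i = 1 ->
  forall (J : finType) (A : {set J}) (w : J -> I -> I -> R),
  (forall j x y, w j x y = w j y x) ->
  density_norm p (fun x y => \sum_(j in A) w j x y) <=
  \sum_(j in A) density_norm p (w j).

Implicit Types I : finType.

Lemma density_norm_ge0 I (p : I -> R) w : 0 <= density_norm p w.
Proof. exact: powR_ge0. Qed.

Lemma density_normX I (p : I -> R) w :
  density_norm p w ^+ #|E| = `|density p E (fun=> w)|.
Proof.
rewrite -powR_mulrn ?density_norm_ge0// /density_norm -powRrM mulVf ?powRr1//.
by rewrite pnatr_eq0 -lt0n.
Qed.

Lemma density_norm_expr_inj I I' (p : I -> R) (p' : I' -> R) w w' c :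
  0 <= c -> `|density p E (fun=> w)| = c ^+ #|E| * `|density p' E (fun=> w')| ->
  density_norm p w = c * density_norm p' w'.
Proof.
move=> c0; rewrite -!density_normX -exprMn => /eqP.
rewrite eqrXn2 ?density_norm_ge0 ?mulr_ge0 ?density_norm_ge0//.
by move/eqP.
Qed.

Lemma density_normZ I (p : I -> R) c w :
  density_norm p (fun x y => c * w x y) = `|c| * density_norm p w.
Proof.
apply: density_norm_expr_inj => //.
by rewrite (densityZ p E (fun=> c) (fun=> w)) normrM prodr_const normrX.
Qed.

Lemma density_norm_pair I (p : I -> R) w :
  density_norm (pair_weight p p) (fun x y => w x.1 y.1 * w x.2 y.2) =
  density_norm p w ^+ 2.
Proof.
rewrite expr2; apply: density_norm_expr_inj; first exact: density_norm_ge0.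
by rewrite (density_pair p p E (fun=> w) (fun=> w)) normrM density_normX.
Qed.

Lemma density_norm1 I (p : I -> R) :
  \sum_i p i = 1 -> density_norm p (fun _ _ => 1) = 1.
Proof. by move=> p1; rewrite /density_norm density1// normr1 powR1. Qed.

Hypothesis density_norm_sum : subadditive_density_norm.

(* Squaring (passing to two independent copies of the labels) makes all terms
   of the expansion of [density (\sum_e w e)] nonnegative, so each of them is
   bounded by the whole sum. *)
Lemma density_sqr_le I (p : I -> R) (w : 'I_n * 'I_n -> I -> I -> R) :
  (forall i, 0 <= p i) -> \sum_i p i = 1 ->
  (forall e x y, w e x y = w e y x) ->
  (forall e, e \in E -> density_norm p (w e) <= 1) ->
  density p E w ^+ 2 <= #|E|%:R ^+ #|E|.
Proof.
move=> p0 p1 wC w1.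
have /card_gt0P[e0 e0E] := E_gt0.
pose w2 e (x y : I * I) := w e x.1 y.1 * w e x.2 y.2.
pose W x y := \sum_(e in E) w2 e x y.
have W_le : `|density (pair_weight p p) E (fun=> W)| <= #|E|%:R ^+ #|E|.
  rewrite -density_normX lerXn2r ?nnegrE ?density_norm_ge0//.
  apply: le_trans; first apply: density_norm_sum.
  - by move=> x; rewrite mulr_ge0.
  - exact: sum_pair_weight.
  - by move=> e x y; rewrite /w2 wC [w e x.2 _]wC.
  - rewrite -[leRHS]mulr1 mulr_natl -sumr_const; apply: ler_sum => e eE.
    by rewrite density_norm_pair exprn_ile1 ?density_norm_ge0// w1.
apply: le_trans (le_trans (ler_norm _) W_le).
rewrite (density_sum _ _ e0).
under eq_bigr => f _ do rewrite /w2 (density_pair p p E (fun e => w (f e))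
  (fun e => w (f e))).
(* The choice giving each edge its own kernel yields the term to be kept; off [E] it must take the
   default value [e0] of the expansion. *)
pose f0 : {ffun 'I_n * 'I_n -> 'I_n * 'I_n} :=
  [ffun e => if e \in E then e else e0].
rewrite (bigD1 f0)/=; last first.
  apply/pffun_onP; split.
    by apply/supportP => e eE; rewrite ffunE (negbTE eE).
  by move=> j /fintype.imageP[e eE ->]; rewrite ffunE eE.
rewrite expr2.
have -> : density p E (fun e => w (f0 e)) = density p E w.
  by apply: eq_density => e x y eE; rewrite ffunE eE.
by rewrite lerDl sumr_ge0// => f _; rewrite -expr2 sqr_ge0.
Qed.

(** The bound of [density_sqr_le] depends only on the number of edges, and squaring the kernels
    keeps their norms at most 1. Hence all 2^k-th powers of the density obey the same bound. *)
Lemma density_le1 I (p : I -> R) (w : 'I_n * 'I_n -> I -> I -> R) :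
  (forall i, 0 <= p i) -> \sum_i p i = 1 ->
  (forall e x y, w e x y = w e y x) ->
  (forall e, e \in E -> density_norm p (w e) <= 1) ->
  `|density p E w| <= 1.
Proof.
move=> p0 p1 wC w1; rewrite -(ler_pXn2r (n := 2))// ?nnegrE// expr1n.
apply: (bounded_expr2n_le1 (B := #|E|%:R ^+ #|E|)); first exact: exprn_ge0.
move=> k; elim: k I p w p0 p1 wC w1 => [|k IH] I p w p0 p1 wC w1.
  by rewrite expn0 expr1 real_normK ?num_real// density_sqr_le.
pose w2 e (x y : I * I) := w e x.1 y.1 * w e x.2 y.2.
have -> : `|density p E w| ^+ 2 = `|density (pair_weight p p) E w2|.
  by rewrite density_pair normrM expr2.
rewrite expnS exprM; apply: IH.
- by move=> x; rewrite mulr_ge0.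
- exact: sum_pair_weight.
- by move=> e x y; rewrite /w2 wC [w e x.2 _]wC.
- by move=> e eE; rewrite density_norm_pair exprn_ile1 ?density_norm_ge0// w1.
Qed.

(** Scaling each edge separately reduces this to norms at most 1. An edge of norm 0 may be scaled by
    any [t], which forces the density to vanish. *)
Theorem density_hoelder I (p : I -> R) (w : 'I_n * 'I_n -> I -> I -> R) :
  (forall i, 0 <= p i) -> \sum_i p i = 1 ->
  (forall e x y, w e x y = w e y x) ->
  `|density p E w| <= \prod_(e in E) density_norm p (w e).
Proof.
move=> p0 p1 wC.
have scaled c : (forall e, 0 <= c e) ->
    (forall e, e \in E -> c e * density_norm p (w e) <= 1) ->
    (\prod_(e in E) c e) * `|density p E w| <= 1.
  move=> c0 c1; have -> : (\prod_(e in E) c e) = `|\prod_(e in E) c e|.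
    by rewrite ger0_norm// prodr_ge0.
  rewrite -normrM -densityZ density_le1//.
    by move=> e x y; rewrite wC.
  by move=> e eE; rewrite density_normZ ger0_norm ?c1.
have [/forall_inP N0|] := boolP [forall e in E, density_norm p (w e) != 0].
  have P0 : 0 < \prod_(e in E) density_norm p (w e).
    by rewrite prodr_gt0// => e eE; rewrite lt_def N0//= density_norm_ge0.
  have := scaled (fun e => (density_norm p (w e))^-1).
  rewrite prodfV => H; rewrite -[leRHS]mulr1 -ler_pdivrMl//; apply: H.
    by move=> e; rewrite invr_ge0 density_norm_ge0.
  by move=> e eE; rewrite mulVf ?N0.
rewrite negb_forall_in => /exists_inP[e0 e0E]; rewrite negbK => /eqP N0.
rewrite (bigD1 e0)//= N0 mul0r.
pose D := \prod_(e in E | e != e0)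
  (if density_norm p (w e) == 0 then 1 else (density_norm p (w e))^-1).
have D0 : 0 < D.
  apply: prodr_gt0 => e _; case: ifPn => // Ne.
  by rewrite invr_gt0 lt_def Ne density_norm_ge0.
have tD t : 0 <= t -> t * D * `|density p E w| <= 1.
  move=> t0; pose c e := if e == e0 then t else
    if density_norm p (w e) == 0 then 1 else (density_norm p (w e))^-1.
  have -> : t * D = \prod_(e in E) c e.
    rewrite (bigD1 e0)//= /c eqxx; congr (_ * _).
    by apply: eq_bigr => e /andP[_ /negbTE ->].
  apply: scaled => [e|e eE]; rewrite /c; case: ifPn => //.
  - by case: ifPn => // _ _; rewrite invr_ge0 density_norm_ge0.
  - by move=> /eqP ->; rewrite N0 mulr0.
  - by case: ifPn => [/eqP ->|Ne _]; rewrite ?mulr0// mulVf.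
(* A nonzero density would permit a [t] for which [tD] reads 2 <= 1. *)
rewrite leNgt; apply/negP => d0.
have /tD : 0 <= 2 / (D * `|density p E w|) by rewrite divr_ge0// mulr_ge0// ltW.
by rewrite -mulrA mulfVK ?gt_eqF ?mulr_gt0// lern1.
Qed.

End hoelder.

(** Since |x| + |y| is the larger of |x + y| and |x - y|, two densities in absolute value can be
    bounded through their sum and difference, where terms cancel. *)
Lemma addr_norm_le {R : realDomainType} (x y B : R) :
  `|x + y| <= B -> `|x - y| <= B -> `|x| + `|y| <= B.
Proof.
rewrite !ler_norml => /andP[? ?] /andP[? ?].
by case: (ler0P x) => ?; case: (ler0P y) => ?; lra.
Qed.

(** * One component, and Hanner's inequality for finite weighted kernels *)

Section hoelder_consequences.
Context {R : realType} {n : nat} (E : {set 'I_n * 'I_n}).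
Hypothesis E_gt0 : (0 < #|E|)%N.
Implicit Types I : finType.
Hypothesis density_norm_sum : subadditive_density_norm (R := R) E.

(** The edges outside [K] carry the constant kernel 1, whose norm is 1 for a probability weight. *)
Lemma density_hoelder_sub (K : {set 'I_n * 'I_n}) I (p : I -> R) w :
  K \subset E -> (forall i, 0 <= p i) -> \sum_i p i = 1 ->
  (forall e x y, w e x y = w e y x) ->
  `|density p K w| <= \prod_(e in K) density_norm E p (w e).
Proof.
move=> KE p0 p1 wC; rewrite -(density_sub _ _ KE).
pose w1 e x y := if e \in K then w e x y else 1.
apply: le_trans (density_hoelder E_gt0 density_norm_sum (w := w1) p0 p1 _) _.
  by move=> e x y; rewrite /w1 wC.
rewrite (bigID [in K])/= [X in _ * X]big1 ?mulr1; last first.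
  by move=> e /andP[_ /negbTE eK]; rewrite /w1 eK density_norm1.
rewrite (eq_bigl [in K]) => [|e]; last by rewrite andb_idl//; exact: (fintype.subsetP KE).
by rewrite le_eqVlt; apply/orP; left; apply/eqP/eq_bigr => e eK; rewrite /w1 eK.
Qed.

Variables (K : {set 'I_n * 'I_n}) (C : {set 'I_n}).
Hypothesis KE : K \subset E.
Hypothesis K_gt0 : (0 < #|K|)%N.
Hypothesis K_in : forall e, e \in K -> (e.1 \in C) && (e.2 \in C).
Hypothesis K_out : forall e, e \in E :\: K -> (e.1 \notin C) && (e.2 \notin C).

(* Both factors of [density E = density K * density (E \ K)] are bounded by the
   power of the norm given by Hoelder, and the product of these bounds is
   attained. *)
Lemma density_component I (p : I -> R) w :
  (forall i, 0 <= p i) -> \sum_i p i = 1 -> (forall x y, w x y = w y x) ->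
  `|density p K (fun=> w)| = density_norm E p w ^+ #|K|.
Proof.
move=> p0 p1 wC; set N := density_norm E p w.
have N0 : 0 <= N by exact: density_norm_ge0.
have le_K (L : {set _}) : L \subset E -> `|density p L (fun=> w)| <= N ^+ #|L|.
  by move=> LE; rewrite -prodr_const; exact: density_hoelder_sub.
have dE : `|density p K (fun=> w)| * `|density p (E :\: K) (fun=> w)| =
    N ^+ #|K| * N ^+ #|E :\: K|.
  rewrite -normrM -(density_split _ p1 K_in K_out).
  have -> : K :|: E :\: K = E.
    apply/finset.setP => e; rewrite !finset.inE.
    by case: (boolP (e \in K)) => // /(fintype.subsetP KE) ->.
  rewrite -density_normX// -/N -exprD; congr (_ ^+ _).
  by rewrite -(cardsID K E) (finset.setIidPr KE).
apply/eqP; rewrite eq_le le_K//=.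
have [->|Nn0] := eqVneq N 0; first by rewrite expr0n gtn_eqF// normr_ge0.
have Np : 0 < N by rewrite lt_def Nn0.
rewrite -(ler_pM2r (exprn_gt0 #|E :\: K| Np)) -dE ler_wpM2l//.
by apply: le_K; rewrite subsetDl.
Qed.

(** The expansions of the densities of x + y and x - y differ by the sign [sg f], as do those of (a
    + b)^m and (a - b)^m with m = [#|K|]. In a sum or a difference the same terms cancel on both
    sides and the others double, and Hoelder compares the survivors one by one. *)
Lemma density_hanner I (p : I -> R) x y :
  ~~ odd #|K| -> (forall i, 0 <= p i) -> \sum_i p i = 1 ->
  (forall i j, x i j = x j i) -> (forall i j, y i j = y j i) ->
  density_norm E p (fun i j => x i j + y i j) ^+ #|K| +
  density_norm E p (fun i j => x i j - y i j) ^+ #|K| <=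
  (density_norm E p x + density_norm E p y) ^+ #|K| +
  (density_norm E p x - density_norm E p y) ^+ #|K|.
Proof.
move=> Kev p0 p1 xC yC.
rewrite -!density_component//; try by move=> i j; rewrite xC yC.
set a := density_norm E p x; set b := density_norm E p y.
pose F := pffun_on false K [set: bool]%SET.
pose sg (f : {ffun 'I_n * 'I_n -> bool}) : R :=
  \prod_(e in K) (if f e then -1 else 1).
pose A (f : {ffun 'I_n * 'I_n -> bool}) :=
  density p K (fun e => if f e then y else x).
pose B (f : {ffun 'I_n * 'I_n -> bool}) := \prod_(e in K) (if f e then b else a).
have sum_bool (G : bool -> R) : \sum_(j in [set: bool]%SET) G j = G true + G false.
  by rewrite -big_bool; apply: eq_bigl => j; rewrite inE.
have dD : density p K (fun=> fun i j => x i j + y i j) = \sum_(f in F) A f.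
  rewrite -(density_sum _ _ false _ (fun e (j : bool) => if j then y else x)).
  by apply: eq_density => e i j _; rewrite sum_bool/= addrC.
have dB : density p K (fun=> fun i j => x i j - y i j) = \sum_(f in F) sg f * A f.
  pose z (j : bool) i k := (if j then -1 else 1) * (if j then y else x) i k.
  transitivity (density p K (fun e i k => \sum_(j in [set: bool]%SET) z j i k)).
    by apply: eq_density => e i j _; rewrite sum_bool/= /z mul1r mulN1r addrC.
  rewrite (density_sum _ _ false _ (fun e j => z j)).
  by apply: eq_bigr => f _; rewrite /sg /A -densityZ.
have eD : (a + b) ^+ #|K| = \sum_(f in F) B f.
  rewrite -(big_distr_big false _ _ (fun e j => if j then b else a))/=.
  by rewrite -prodr_const; apply: eq_bigr => e _; rewrite sum_bool addrC.
have eB : (a - b) ^+ #|K| = \sum_(f in F) sg f * B f.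
  under eq_bigr => f _ do rewrite /sg /B -big_split/=.
  rewrite -(big_distr_big false _ _
    (fun e (j : bool) => (if j then -1 else 1) * (if j then b else a)))/=.
  rewrite -prodr_const; apply: eq_bigr => e _.
  by rewrite sum_bool mulN1r mul1r addrC.
have AB f : `|A f| <= B f.
  apply: le_trans (density_hoelder_sub KE p0 p1 _) _.
    by move=> e i j; case: (f e).
  rewrite le_eqVlt; apply/orP; left; apply/eqP; apply: eq_bigr => e _.
  by case: (f e).
have sgE f : sg f = 1 \/ sg f = -1.
  rewrite /sg; elim/big_rec: _ => [|e s _ [] ->]; first by left.
    by case: (f e); [right|left]; rewrite ?mulr1.
  by case: (f e); [left|right]; rewrite ?mulrN1 ?opprK ?mul1r.
(* Evenness enters here: the difference of the two densities is bounded by (a + b)^m - (a - b)^m,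
   which must not exceed the sum. *)
have ab_ge0 : 0 <= (a - b) ^+ #|K| by rewrite exprn_even_ge0.
apply: addr_norm_le; rewrite dD dB.
  rewrite eD eB -!big_split/= (le_trans (ler_norm_sum _ _ _))//.
  apply: ler_sum => f _; have := AB f; have := normr_ge0 (A f).
  by case: (sgE f) => ->; rewrite ?mul1r ?mulN1r ?subrr ?normr0//;
    rewrite -mulr2n normrMn; lra.
apply: (@le_trans _ _ ((a + b) ^+ #|K| - (a - b) ^+ #|K|)); last by lra.
rewrite eD eB -!sumrB (le_trans (ler_norm_sum _ _ _))//.
apply: ler_sum => f _; have := AB f; have := normr_ge0 (A f).
case: (sgE f) => ->; rewrite ?mul1r ?mulN1r ?subrr ?normr0 ?opprK//.
by rewrite -mulr2n normrMn; lra.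
Qed.

End hoelder_consequences.

(** * Components and diagonal kernels *)

Section graph_component.
Context {n : nat} (E : rel 'I_n).
Hypothesis E_sym : symmetric E.
Hypothesis E_irr : irreflexive E.
Variable v0 : 'I_n.
Let C := component E v0.
Let K := edges_in E C.

Lemma edges_in_sub : K \subset edges E.
Proof. by apply/fintype.subsetP => e; rewrite inE => /andP[]. Qed.

Lemma edges_inP e : e \in K -> (e.1 \in C) && (e.2 \in C).
Proof. by rewrite inE => /andP[]. Qed.

Lemma edges_notinP e : e \in edges E :\: K -> (e.1 \notin C) && (e.2 \notin C).
Proof.
rewrite inE => /andP[eK eE]; have := eK; rewrite inE eE/=.
have E12 : E e.1 e.2 by move: eE; rewrite inE => /andP[].
have -> : (e.2 \in C) = (e.1 \in C).
  rewrite !inE; apply/idP/idP => h; apply: connect_trans h (connect1 _) => //.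
  by rewrite E_sym.
by rewrite andbb => ->.
Qed.

(** Follows a path from [v0]. An edge is stored with increasing endpoints, so each step of the path
    distinguishes its two directions. *)
Lemma constant_on_component (I : eqType) (a : 'I_n -> I) :
  (forall e, e \in K -> a e.1 = a e.2) -> forall v, v \in C -> a v = a v0.
Proof.
move=> aK v.
suff gen s u : a u = a v0 -> u \in C -> path E u s -> a (last u s) = a v0.
  rewrite inE => /connectP[s v0s ->].
  by apply: gen => //; rewrite inE connect0.
elim: s u => [|x s IH] u au uC //= /andP[Eux].
have xC : x \in C.
  by move: uC; rewrite !inE => h; apply: connect_trans h (connect1 Eux).
apply: IH => //; rewrite -au.
have [ux|xu|ux] := ltngtP u x; last by move: Eux; rewrite (val_inj ux) E_irr.
- by rewrite (aK (u, x))// !inE/= ux Eux/=; rewrite !inE in uC xC; rewrite uC.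
- rewrite -(aK (x, u))// !inE/= xu E_sym Eux/=; rewrite !inE in uC xC.
  by rewrite uC xC.
Qed.

(** Only labellings constant on the component contribute; each vertex of [C] then gives a factor
    [p i], each vertex outside a factor 1. *)
Lemma density_diag {R : realType} (I : finType) (p : I -> R) (x : I -> R) :
  (0 < #|K|)%N -> \sum_i p i = 1 ->
  density p K (fun=> fun i j => if i == j then x i else 0) =
  \sum_i p i ^+ #|C| * x i ^+ #|K|.
Proof.
move=> K_gt0 p1; rewrite /density.
(* Constancy on [C] is written as a product of indicators over all vertices, so that the sum over
   labellings factors vertex by vertex. *)
have diagE (a : {ffun 'I_n -> I}) :
    \prod_(e in K) (if a e.1 == a e.2 then x (a e.1) else 0) =
    \sum_i (\prod_v (if v \in C then (a v == i)%:R else 1)) * x i ^+ #|K|.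
  have [/forall_inP aK|] := boolP [forall e in K, a e.1 == a e.2].
    have aC v : v \in C -> a v = a v0.
      by apply: constant_on_component => e /aK/eqP.
    rewrite (bigD1 (a v0))//= [X in _ + X]big1 ?addr0 => [|i i0]; last first.
      rewrite (bigD1 v0)//= inE connect0 eq_sym (negbTE i0) ?mul0r//.
    rewrite [X in X * _]big1 ?mul1r => [|v _]; last first.
      by case: ifPn => // /aC ->; rewrite eqxx.
    rewrite -prodr_const; apply: eq_bigr => e eK.
    by rewrite aK// aC//; case/andP: (edges_inP eK).
  rewrite negb_forall_in => /exists_inP[e eK /negbTE ae].
  rewrite (bigD1 e)//= ae mul0r big1// => i _.
  have /andP[e1 e2] := edges_inP eK.
  have [a1|a1] := eqVneq (a e.1) i; last first.
    by rewrite (bigD1 e.1)//= e1 (negbTE a1) !mul0r.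
  by rewrite (bigD1 e.2)//= e2 -a1 eq_sym ae !mul0r.
under eq_bigr => a _ do rewrite diagE mulr_sumr.
rewrite exchange_big/=; apply: eq_bigr => i _.
under eq_bigr => a _ do rewrite mulrA /tuple_weight -big_split/=.
rewrite -mulr_suml; congr (_ * _).
rewrite -(bigA_distr_bigA
  (fun v j => p j * (if v \in C then (j == i)%:R else 1)))/=.
rewrite -prodr_const [RHS]big_mkcond/=; apply: eq_bigr => v _.
case: ifPn => vC; last by under eq_bigr do rewrite mulr1.
rewrite (bigD1 i)//= eqxx mulr1 big1 ?addr0// => j /negbTE ->.
by rewrite mulr0.
Qed.

End graph_component.

Section component_norm.
Context {R : realType} {n : nat} (E : rel 'I_n).
Hypothesis E_sym : symmetric E.
Hypothesis E_irr : irreflexive E.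
Variable v0 : 'I_n.
Let C := component E v0.
Let K := edges_in E C.
Hypothesis K_gt0 : (0 < #|K|)%N.
Hypothesis density_norm_sum : subadditive_density_norm (R := R) (edges E).

Lemma edges_gt0 : (0 < #|edges E|)%N.
Proof. exact: leq_trans K_gt0 (subset_leq_card (edges_in_sub E v0)). Qed.

(** For even [#|K|] the diagonal kernels thus carry a weighted l^m norm, with m the size of one
    component rather than of the whole graph. *)
Lemma density_norm_diag (I : finType) (p : I -> R) (x : I -> R) :
  (forall i, 0 <= p i) -> \sum_i p i = 1 ->
  density_norm (edges E) p (fun i j => if i == j then x i else 0) ^+ #|K| =
  `|\sum_i p i ^+ #|C| * x i ^+ #|K| |.
Proof.
move=> p0 p1; rewrite -density_diag//.
rewrite -(density_component edges_gt0 density_norm_sum (edges_in_sub E v0) K_gt0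
  (@edges_inP _ E v0) (@edges_notinP _ E E_sym v0))//.
by move=> i j; rewrite eq_sym; case: eqP => // ->.
Qed.

(* For odd [#|K|] the diagonal matrix (1,-1) has norm 0, so that (1,1) and
   (2,0) would have the same norm. *)
Lemma component_even : (1 < #|K|)%N -> ~~ odd #|K|.
Proof.
move=> K_gt1; apply/negP => Kodd.
pose p (_ : bool) : R := 2^-1.
have p0 i : 0 <= p i by rewrite invr_ge0.
have p1 : \sum_i p i = 1 by rewrite big_bool/= /p; lra.
pose D (x : bool -> R) (i j : bool) := if i == j then x i else 0.
have DN x := density_norm_diag x p0 p1; rewrite -/D in DN.
pose x1 (b : bool) : R := if b then 2 else 0.
pose x2 (b : bool) : R := if b then 1 else 1.
pose x3 (b : bool) : R := if b then 1 else -1.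
have [c [c0 cD]] : exists c : R, 0 < c /\ forall x,
    density_norm (edges E) p (D x) ^+ #|K| =
    c * `|x true ^+ #|K| + x false ^+ #|K| |.
  exists (2^-1 ^+ #|C|); split; first by rewrite exprn_gt0// invr_gt0.
  move=> x; rewrite DN big_bool/= -mulrDr normrM ger0_norm//.
  by rewrite exprn_ge0// invr_ge0.
have N3 : density_norm (edges E) p (D x3) = 0.
  have := cD x3; rewrite /x3 expr1n -signr_odd Kodd expr1 subrr normr0 mulr0.
  by move/eqP; rewrite expf_eq0 K_gt0 => /eqP.
have : density_norm (edges E) p (D x1) <=
    density_norm (edges E) p (D x2) + density_norm (edges E) p (D x3).
  have := @density_norm_sum _ p p0 p1 _ [set: bool]%SET
    (fun b => D (if b then x2 else x3)).
  have sum_bool (G : bool -> R) : \sum_(j in [set: bool]%SET) G j = G true + G false.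
    by rewrite -big_bool; apply: eq_bigl => j; rewrite inE.
  rewrite sum_bool => H; apply: le_trans (H _).
    rewrite le_eqVlt; apply/orP; left; apply/eqP; congr (density_norm _ _ _).
    apply/funext => i; apply/funext => j; rewrite sum_bool /D /x1 /x2 /x3.
    by case: i; case: j => //=; lra.
  by move=> b i j; rewrite /D eq_sym; case: eqP => // ->.
rewrite N3 addr0 -(ler_pXn2r K_gt0) ?nnegrE ?density_norm_ge0// !cD.
(* Raised to the power m, the triangle inequality has become 2^m <= 1 + 1. *)
rewrite /x1 /x2 expr0n (gtn_eqF K_gt0) addr0 expr1n ger0_norm; last first.
  by rewrite exprn_ge0.
rewrite ger0_norm ?addr_ge0// ler_pM2l// => K_le.
have : (2 : R) ^+ 2 <= 2 ^+ #|K| by rewrite ler_weXn2l// ler1n.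
by move=> /le_trans/(_ K_le); rewrite expr2; lra.
Qed.

End component_norm.

(** * Step kernels on an atomless space *)

Section atomless_partition.
Context {R : realType} {d : measure_display} {T : measurableType d}.
Variable nu : probability T R.
Hypothesis nu_atomless : atomless nu.

Let v (A : set T) : R := fine (nu A).

Let nuE A : measurable A -> nu A = (v A)%:E.
Proof. by move=> mA; rewrite /v fineK ?fin_num_measure. Qed.

Let v_ge0 A : 0 <= v A.
Proof. by rewrite fine_ge0. Qed.

Let v0 : v set0 = 0.
Proof. by rewrite /v measure0. Qed.

Let vU A B : measurable A -> measurable B -> A `&` B = set0 ->
  v (A `|` B) = v A + v B.
Proof.
move=> mA mB AB; apply: EFin_inj.
by rewrite EFinD -!nuE//; [exact: measureU|exact: measurableU].
Qed.

Let vD A B : measurable A -> measurable B -> B `<=` A ->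
  v (A `\` B) = v A - v B.
Proof.
move=> mA mB BA.
have -> : v A = v B + v (A `\` B).
  rewrite -vU//; first by rewrite setDUK.
    exact: measurableD.
  by rewrite setDE setICA setICr setI0.
by rewrite addrC addKr.
Qed.

Let v_le A B : measurable A -> measurable B -> A `<=` B -> v A <= v B.
Proof. by move=> mA mB AB; rewrite -subr_ge0 -vD. Qed.

(** A set of intermediate measure or its complement in [B] has at most half the measure of [B];
    iterate. *)
Lemma atomless_small A (e : R) : measurable A -> 0 < v A -> 0 < e ->
  exists B, [/\ measurable B, B `<=` A, 0 < v B & v B <= e].
Proof.
move=> mA A0 e0.
have halving k : exists B, [/\ measurable B, B `<=` A, 0 < v B &
    v B <= v A / 2 ^+ k].
  elim: k => [|k [B [mB BA B0 Bk]]].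
    by exists A; split => //; rewrite expr0 divr1.
  have [|C mC [CB]] := nu_atomless mB; first by rewrite nuE.
  rewrite !nuE// !lte_fin => /andP[C0 CltB].
  have half x : x <= v B / 2 -> x <= v A / 2 ^+ k.+1.
    move=> /le_trans; apply; rewrite exprSr invfM mulrA.
    by rewrite ler_wpM2r ?invr_ge0.
  have [Cle|Cgt] := leP (v C) (v B / 2).
    by exists C; split => //; [exact: subset_trans BA|exact: half].
  exists (B `\` C); split.
  - exact: measurableD.
  - exact: subset_trans BA.
  - by rewrite vD// subr_gt0.
  - by apply: half; rewrite vD//; lra.
pose k := (Num.truncn (v A / e)).+1.
have [B [mB BA B0 Bk]] := halving k; exists B; split => //.
rewrite (le_trans Bk)// ler_pdivrMr ?exprn_gt0// mulrC -ler_pdivrMr//.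
rewrite (le_trans (ltW (truncnS_gt _)))// -natrX ler_nat.
exact/ltnW/ltn_expl.
Qed.

(* Sierpinski's theorem.  The set is the union of a greedy sequence, each step
   adding at least half of the largest measure that can be added; a positive
   deficit would allow adding a set of fixed positive measure at every step. *)
Lemma atomless_subset A (c : R) : measurable A -> 0 <= c <= v A ->
  exists2 B, measurable B & B `<=` A /\ v B = c.
Proof.
move=> mA /andP[c0 cA].
pose good B := [/\ measurable B, B `<=` A & v B <= c].
pose cand B D := [/\ measurable D, D `<=` A `\` B & v B + v D <= c].
(* The implication stands under the existential, so [choice] returns a step function defined on all
   sets. *)
have step B : exists B', good B -> [/\ good B', B `<=` B' &
    forall D, cand B D -> v D <= 2 * (v B' - v B)].
  have [gB|nB] := pselect (good B); last by exists B => /nB.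
  have [mB BA Bc] := gB.
  pose S := [set v D | D in cand B].
  have S0 : S 0 by exists set0 => //; split; rewrite ?v0 ?addr0.
  have supS : has_sup S.
    by split; [exists 0|exists c => _ [D [_ _ Dc] <-]; have := v_ge0 B; lra].
  have candP D : cand B D -> v D <= sup S.
    by move=> cD; apply: ub_le_sup; [exact: supS.2|exists D].
  have [s0|s0] := leP (sup S) 0.
    exists B => _; split => // D /candP vDs.
    by rewrite subrr mulr0 (le_trans vDs).
  have [|_ [D cD <-] Ds] := @sup_adherent _ S (sup S / 2) _ supS.
    by rewrite divr_gt0.
  have [mD DAB Dc] := cD; have BD0 : B `&` D = set0.
    by apply/seteqP; split => // x [Bx /DAB[_ /(_ Bx)]].
  exists (B `|` D) => _; split.
  - split; first exact: measurableU.
    + by move=> x [/BA//|/DAB[]].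
    + by rewrite vU.
  - by move=> x; left.
  - by move=> D' /candP; rewrite vU//; lra.
have [F FP] := choice step.
pose B_ k := iter k F set0.
have gB k : good (B_ k).
  elim: k => [|k IH]; first by rewrite /B_/=; split; rewrite ?v0//.
  by have [] := FP _ IH.
have BS k : B_ k `<=` B_ k.+1 by have [] := FP _ (gB k).
have mB k : measurable (B_ k) by have [] := gB k.
pose B := \bigcup_k B_ k.
have mBB : measurable B by exact: bigcup_measurable.
have BA : B `<=` A by move=> x [k _ Bkx]; have [_ BkA _] := gB k; exact: BkA.
have Bc : v B <= c.
  have Bcvg : nu \o B_ @ \oo --> nu B.
    apply: nondecreasing_cvg_mu => //.
    by apply/nondecreasing_seqP => k; apply/subsetPset/BS.
  rewrite -lee_fin -nuE// -(cvg_lim _ Bcvg)//.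
  apply: lime_le; first by apply/cvg_ex; exists (nu B).
  by apply: nearW => k /=; rewrite nuE// lee_fin; have [] := gB k.
exists B => //; split => //; apply/eqP; rewrite eq_le Bc/= leNgt; apply/negP => Blt.
have [|||D [mD DAB D0 Dc]] := @atomless_small (A `\` B) (c - v B).
- exact: measurableD.
- by rewrite vD// subr_gt0 (lt_le_trans Blt).
- by rewrite subr_gt0.
have incr k : v D <= 2 * (v (B_ k.+1) - v (B_ k)).
  have [_ _ ] := FP _ (gB k); apply; split => //.
    by move=> x /DAB[Ax Bx]; split => // Bkx; apply: Bx; exists k.
  have : v (B_ k) <= v B by apply: v_le => // x Bkx; exists k.
  lra.
have sumD k : v D *+ k <= 2 * v (B_ k).
  elim: k => [|k IH]; first by rewrite mulr0n v0 mulr0.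
  by rewrite mulrS; have := incr k; lra.
pose k := (Num.truncn (2 * c / v D)).+1.
have : 2 * c < v D *+ k by rewrite -[v D *+ k]mulr_natl -ltr_pdivrMr// truncnS_gt.
by have [_ _ ] := gB k; have := sumD k; lra.
Qed.

(** Labels are cut off one at a time by [atomless_subset]; the last one receives all that remains,
    which has the right measure because the weights add up to that of the whole space. *)
Lemma atomless_partition (I : finType) (p : I -> R) :
  (forall i, 0 <= p i) -> \sum_i p i = 1 ->
  exists2 f : T -> I, (forall i, measurable (f @^-1` [set i])) &
    forall i, nu (f @^-1` [set i]) = (p i)%:E.
Proof.
move=> p0 p1.
have gen (s : seq I) (i0 : I) (A : set T) : uniq (i0 :: s) -> measurable A ->
    v A = \sum_(i <- i0 :: s) p i -> exists f : T -> I, forall i,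
    measurable (A `&` f @^-1` [set i]) /\
    v (A `&` f @^-1` [set i]) = if i \in i0 :: s then p i else 0.
  elim: s i0 A => [|i1 s IH] i0 A.
    move=> _ mA; rewrite big_seq1 => vA; exists (fun=> i0) => i.
    rewrite inE; case: eqVneq => [->|i0i].
      by rewrite (_ : _ @^-1` _ = setT) ?setIT//; apply/seteqP; split.
    rewrite (_ : _ @^-1` _ = set0) ?setI0 ?v0//.
    by apply/seteqP; split => // x /= /esym/eqP; rewrite (negbTE i0i).
  rewrite cons_uniq => /andP[i0s us] mA; rewrite big_cons => vA.
  have s_ge0 : 0 <= \sum_(i <- i1 :: s) p i by exact: sumr_ge0.
  have [|B mB [BA vB]] := @atomless_subset A (p i0) mA.
    by rewrite p0 vA lerDl.
  have mAB : measurable (A `\` B) by exact: measurableD.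
  have [|f fP] := IH i1 (A `\` B) us mAB.
    by rewrite vD// vA vB addrC addKr.
  exists (fun x => if x \in B then i0 else f x) => i.
  have [mf vf] := fP i.
  have [->|ii0] := eqVneq i i0.
    have -> : A `&` (fun x => if x \in B then i0 else f x) @^-1` [set i0] =
        B `|` (A `\` B) `&` f @^-1` [set i0].
      apply/seteqP; split => x /=.
        by case: (boolP (x \in B)); rewrite ?inE ?notin_setE => Bx [Ax fx];
          [left|right].
      move=> [Bx|[[Ax Bx] fx]]; first by rewrite mem_set//; split => //; exact: BA.
      by rewrite memNset.
    have [mf0 vf0] := fP i0; rewrite (negbTE i0s) in vf0.
    split; first exact: measurableU.
    rewrite vU//; last by apply/seteqP; split => // x [Bx [[_ /(_ Bx)]]].
    by rewrite vf0 addr0 vB mem_head.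
  rewrite in_cons (negbTE ii0)/= -vf.
  suff -> : A `&` (fun x => if x \in B then i0 else f x) @^-1` [set i] =
      (A `\` B) `&` f @^-1` [set i] by [].
  apply/seteqP; split => x /=.
    case: (boolP (x \in B)); rewrite ?inE ?notin_setE => Bx [Ax fx] //.
    by move: ii0; rewrite -fx eqxx.
  by move=> [[Ax Bx] fx]; rewrite memNset.
have: \sum_(i <- enum I) p i = 1 by rewrite big_enum.
have: uniq (enum I) by exact: enum_uniq.
have: enum I =i I by exact: mem_enum.
case: (enum I) => [|i0 s] sI us sp.
  by move: sp; rewrite big_nil => /esym/eqP; rewrite oner_eq0.
have [|f fP] := gen s i0 setT us measurableT.
  by rewrite sp /v probability_setT.
by exists f => i; have [] := fP i; rewrite setTI sI // => mf vf; rewrite nuE// vf.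
Qed.

End atomless_partition.

Section finite_range.
Context {d : measure_display} {X : measurableType d} {R : realType}.
Variables (J : finType) (g : X -> J).
Hypothesis mg : forall j, measurable (g @^-1` [set j]).

Lemma measurable_finite_range d' (Y : measurableType d') (G : J -> Y) :
  measurable_fun [set: X] (G \o g).
Proof.
move=> _ B mB; rewrite setTI.
have -> : (G \o g) @^-1` B = \bigcup_(j in [set j | B (G j)]) g @^-1` [set j].
  by apply/seteqP; split => [x Bx|x [j /= Bj gx]];
    [exists (g x)|rewrite /preimage/= gx].
apply: fin_bigcup_measurable => //; exact: finite_finset.
Qed.

Lemma finite_range_integrable (P : probability X R) (G : J -> R) :
  P.-integrable [set: X] (EFin \o (G \o g)).
Proof.
apply: measurable_bounded_integrable => //.
- by rewrite (le_lt_trans (probability_le1 _ _))// ltry.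
- exact: measurable_finite_range.
- exists (\sum_j `|G j|); split; first exact: num_real.
  move=> M GM x _; apply/ltW/(le_lt_trans _ GM) => /=.
  by rewrite (bigD1 (g x))//= lerDl sumr_ge0.
Qed.

Lemma Rintegral_finite_range (P : probability X R) (G : J -> R) :
  (\int[P]_x G (g x) = \sum_j G j * fine (P (g @^-1` [set j])))%R.
Proof.
have mI j : P.-integrable [set: X] (fun x => (\1_(g @^-1` [set j]) x : R)%:E).
  exact: integrable_indic.
rewrite /Rintegral.
under eq_integral => x _.
  rewrite (_ : (G (g x))%:E =
      \sum_j ((G j)%:E * (\1_(g @^-1` [set j]) x : R)%:E)%E); last first.
    rewrite (bigD1 (g x))//= big1 ?adde0 => [|j jg].
      by rewrite indicE mem_set// mule1.
    rewrite indicE memNset ?mule0//= => gj.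
    by rewrite gj eqxx in jg.
  over.
rewrite integral_sum//; last by move=> j; exact: integrableZl.
rewrite [LHS](_ : _ = fine (\sum_j (G j * fine (P (g @^-1` [set j])))%:E)%E).
  by rewrite sumEFin.
congr fine; apply: eq_bigr => j _.
rewrite integralZl// integral_indic// setIT EFinM; congr (_ * _)%E.
by rewrite fineK ?fin_num_measure.
Qed.

End finite_range.

Section step_kernel.
Context {R : realType} {d : measure_display} {T : measurableType d}.
Variable nu : probability T R.
Context {n : nat} (E : rel 'I_n).

Definition step_kernel (I : finType) (f : T -> I) (w : I -> I -> R) (x : T * T) : R :=
  w (f x.1) (f x.2).

Variables (I : finType) (f : T -> I).
Hypothesis mf : forall i, measurable (f @^-1` [set i]).

Lemma measurable_step_kernel w :
  measurable_fun [set: T * T] (step_kernel f w).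
Proof.
apply: (@measurable_finite_range _ _ _ (fun x : T * T => (f x.1, f x.2)) _ _ _
  (fun ij => w ij.1 ij.2)) => -[i j].
have -> : (fun x : T * T => (f x.1, f x.2)) @^-1` [set (i, j)] =
    (f @^-1` [set i]) `*` (f @^-1` [set j]).
  by apply/seteqP; split => -[x y] /= [-> ->].
exact: measurableX.
Qed.

Let label (x : n.-tuple T) : {ffun 'I_n -> I} := [ffun i => f (tnth x i)].

Let labelE a : label @^-1` [set a] =
  [set x | forall i, (f @^-1` [set a i]) (tnth x i)].
Proof.
apply/seteqP; split => [x /= <- i|x /= xa]; first by rewrite ffunE.
by apply/ffunP => i; rewrite ffunE xa.
Qed.

Let mlabel a : measurable (label @^-1` [set a]).
Proof.
rewrite labelE (_ : [set x | _] = \bigcap_(i in [set: 'I_n])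
    (@tnth n T ^~ i) @^-1` (f @^-1` [set a i])); last first.
  by apply/seteqP; split => [x Bx i _|x Bx i]; [exact: Bx|exact: Bx].
apply: fin_bigcap_measurable => //= i _.
by rewrite -[X in measurable X]setTI; exact: measurable_tnth.
Qed.

Let hom_integrand_step w : hom_integrand E (step_kernel f w) =
  (fun a : {ffun 'I_n -> I} => \prod_(e in edges E) w (a e.1) (a e.2)) \o label.
Proof.
apply/funext => x; rewrite /hom_integrand /=; apply: eq_bigr => e _.
by rewrite /step_kernel !ffunE.
Qed.

Lemma kernel_space_step w : (forall i j, w i j = w j i) ->
  kernel_space nu E (step_kernel f w).
Proof.
move=> wC; split; first exact: measurable_step_kernel.
  by move=> x y; exact: wC.
by rewrite hom_integrand_step; exact: finite_range_integrable.
Qed.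

(** The integrand depends only on the labels of the coordinates, and each labelling is attained on a
    box, whose measure is [tuple_weight]. *)
Lemma hom_density_step (p : I -> R) w :
  (forall i, nu (f @^-1` [set i]) = (p i)%:E) ->
  hom_density nu E (step_kernel f w) = density p (edges E) (fun=> w).
Proof.
move=> nup; rewrite /hom_density hom_integrand_step.
rewrite (Rintegral_finite_range mlabel _
  (fun a : {ffun 'I_n -> I} => \prod_(e in edges E) w (a e.1) (a e.2))).
apply: eq_bigr => a _; rewrite mulrC labelE.
rewrite (power_measure_box nu (A := fun i => f @^-1` [set a i]))//; congr (_ * _).
by under eq_bigr => i _ do rewrite nup; rewrite prodEFin.
Qed.

Lemma graph_norm_step (p : I -> R) w :
  (forall i, nu (f @^-1` [set i]) = (p i)%:E) ->
  graph_norm nu E (step_kernel f w) = density_norm (edges E) p w.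
Proof. by move=> nup; rewrite /graph_norm (hom_density_step _ nup). Qed.

End step_kernel.

Lemma seminorming_edges_gt0 {R : realType} {d} {T : measurableType d}
    (nu : probability T R) n (E : rel 'I_n) :
  seminorming nu E -> (0 < #|edges E|)%N.
Proof.
move=> [[V0 _ _] _ N_hom _]; rewrite lt0n; apply/negP => /eqP E0.
have := N_hom 0 0 V0; rewrite normr0 mul0r /graph_norm E0 invr0 powRr0.
by move/eqP; rewrite oner_eq0.
Qed.

(** Any finite weighted label set, product sets included, is the law of a partition of the given
    space, so the triangle inequality transfers from step kernels to matrices. *)
Lemma seminorming_density_norm_sum {R : realType} {d} {T : measurableType d}
    (nu : probability T R) n (E : rel 'I_n) :
  atomless nu -> seminorming nu E -> subadditive_density_norm (R := R) (edges E).
Proof.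
move=> nu_atomless [[V0 VD _] N_ge0 N_hom N_tri] I p p0 p1 J A w wC.
have [f mf nuf] := atomless_partition nu_atomless p0 p1.
rewrite -(graph_norm_step E mf _ nuf).
under eq_bigr => j _ do rewrite -(graph_norm_step E mf _ nuf).
have -> : step_kernel f (fun x y => \sum_(j in A) w j x y) =
    \sum_(j in A) step_kernel f (w j).
  by apply/funext => x; rewrite fct_sumE.
(* Membership is carried along because the triangle inequality is only available inside
   [kernel_space]. *)
suff [] : kernel_space nu E (\sum_(j in A) step_kernel f (w j)) /\
  graph_norm nu E (\sum_(j in A) step_kernel f (w j)) <=
  \sum_(j in A) graph_norm nu E (step_kernel f (w j)) by [].
elim/big_rec2: _ => [|j s W _ [VW NW]].
  by split => //; have := N_hom 0 0 V0; rewrite scale0r normr0 mul0r => ->.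
have Vj := kernel_space_step nu E mf (wC j).
split; first exact: VD.
by rewrite (le_trans (N_tri _ _ Vj VW))// lerD2l.
Qed.

(** * Approximation by step kernels *)

Section L1_distance.
Context {d : measure_display} {X : measurableType d} {R : realType}.
Variable Q : probability X R.

(** Extended-real valued, so that comparisons need measurability but no integrability. *)
Definition L1dist (f g : X -> R) : \bar R := (\int[Q]_x (`|f x - g x|)%:E)%E.

Let mdist (f g : X -> R) : measurable_fun [set: X] f -> measurable_fun [set: X] g ->
  @measurable_fun _ _ X (\bar R) [set: X]
    (fun x => (`|f x - g x|)%:E).
Proof.
move=> mf mg; apply/measurable_EFinP; apply: measurableT_comp => //.
exact: measurable_funB.
Qed.

(** Two pairs on the right serve both the triangle inequality and Lipschitz operations on two
    functions. *)
Lemma L1dist_le (K : R) (f1 g1 f2 g2 f g : X -> R) :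
  measurable_fun [set: X] f1 -> measurable_fun [set: X] g1 ->
  measurable_fun [set: X] f2 -> measurable_fun [set: X] g2 ->
  measurable_fun [set: X] f -> measurable_fun [set: X] g ->
  0 <= K -> (forall x, `|f x - g x| <= K * (`|f1 x - g1 x| + `|f2 x - g2 x|)) ->
  (L1dist f g <= K%:E * (L1dist f1 g1 + L1dist f2 g2))%E.
Proof.
move=> mf1 mg1 mf2 mg2 mf mg K0 fg.
rewrite /L1dist -ge0_integralD//; [|exact: mdist|exact: mdist].
rewrite -ge0_integralZl_EFin//; last by apply: emeasurable_funD; exact: mdist.
apply: ge0_le_integral => //; first exact: mdist.
- by apply: measurable_funeM; apply: emeasurable_funD; exact: mdist.
- by move=> x _; rewrite -EFinD -EFinM lee_fin.
- by move=> x _; rewrite adde_ge0.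
Qed.

Lemma L1dist_bigcup (B : (set X)^nat) (e : R) :
  (forall k, measurable (B k)) -> 0 < e ->
  exists k, (L1dist (\1_(\bigcup_i B i)) (\1_(\big[setU/set0]_(i < k) B i)) <= e%:E)%E.
Proof.
move=> mB e0; have mU : measurable (\bigcup_k B k) by exact: bigcup_measurable.
pose U k := \big[setU/set0]_(i < k) B i.
have mUk k : measurable (U k) by exact: bigsetU_measurable.
have UU : \bigcup_k U k = \bigcup_k B k.
  apply/seteqP; split => x [k _].
    by rewrite /U -bigcup_mkord => -[i _ Bx]; exists i.
  by move=> Bx; exists k.+1 => //; rewrite /U big_ord_recr; right.
have Ucvg : Q \o U @ \oo --> Q (\bigcup_k B k).
  rewrite -UU; apply: nondecreasing_cvg_mu => //; first by rewrite UU.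
  apply/nondecreasing_seqP => k; apply/subsetPset.
  by rewrite /U big_ord_recr; left.
have fin B' : measurable B' -> Q B' \is a fin_num.
  by move=> mB'; exact: fin_num_measure.
move: Ucvg; rewrite -(fineK (fin _ mU)) => /fine_cvgP[_ /cvgrPdist_le/(_ e e0)].
move=> [k _ /(_ k (leqnn k))] /= Uk; exists k; rewrite -/(U k).
rewrite /L1dist; under eq_integral => z _.
  rewrite (_ : `|_| = \1_(\bigcup_k B k `\` U k) z); last first.
    rewrite !indicE in_setD.
    case: (boolP (z \in U k)) => [|_]; last first.
      by rewrite subr0 andbT; case: (_ \in _); rewrite ?normr1 ?normr0.
    rewrite inE => Uz; rewrite (mem_set (A := \bigcup_k B k)).
      by rewrite subrr normr0.
    by rewrite -UU; exists k.
  over.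
rewrite integral_indic//; last exact: measurableD.
rewrite setIT measureD//; last first.
  by rewrite (le_lt_trans (probability_le1 _ _))// ltry.
rewrite (setIidr (_ : U k `<=` _)); last by rewrite -UU; exact: bigcup_sup.
rewrite -[X in (X - _ <= _)%E](fineK (fin _ mU)).
rewrite -[X in (_ - X <= _)%E](fineK (fin _ (mUk k))) -EFinB lee_fin.
exact: le_trans (ler_norm _) Uk.
Qed.

End L1_distance.

Section step_approximation.
Import HBSimple.
Context {R : realType} {d : measure_display} {T : measurableType d}.
Variable nu : probability T R.

Definition is_step (S : T * T -> R) : Prop :=
  exists (I : finType) (f : T -> I) (w : I -> I -> R),
    (forall i, measurable (f @^-1` [set i])) /\ S = step_kernel f w.

Lemma is_step_measurable S : is_step S -> measurable_fun [set: T * T] S.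
Proof. by move=> [I [f [w [mf ->]]]]; exact: measurable_step_kernel. Qed.

Lemma measurable_pair_label (I J : finType) (f : T -> I) (g : T -> J) :
  (forall i, measurable (f @^-1` [set i])) ->
  (forall j, measurable (g @^-1` [set j])) ->
  forall k, measurable ((fun x => (f x, g x)) @^-1` [set k]).
Proof.
move=> mf mg [i j].
rewrite (_ : _ @^-1` _ = f @^-1` [set i] `&` g @^-1` [set j]).
  exact: measurableI.
by apply/seteqP; split => x /= [-> ->].
Qed.

Lemma is_step_map2 (op : R -> R -> R) S1 S2 : is_step S1 -> is_step S2 ->
  is_step (fun z => op (S1 z) (S2 z)).
Proof.
move=> [I [f [w [mf ->]]]] [J [g [u [mg ->]]]].
exists (I * J)%type, (fun x => (f x, g x)),
  (fun k l => op (w k.1 l.1) (u k.2 l.2)); split => //.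
exact: measurable_pair_label.
Qed.

(** A step kernel labels both coordinates by the same map, so the label records membership in [A]
    and in [B]. *)
Lemma is_step_rect (A B : set T) : measurable A -> measurable B ->
  is_step (\1_(A `*` B)).
Proof.
move=> mA mB.
have mI (C : set T) : measurable C -> forall b, measurable ((fun x => x \in C) @^-1` [set b]).
  move=> mC b; rewrite (_ : _ @^-1` _ = if b then C else ~` C).
    by case: b => //; exact: measurableC.
  apply/seteqP; split => x /=; first by move=> <-; case: ifPn; rewrite ?inE ?notin_setE.
  by case: b => Cx; [rewrite mem_set|rewrite memNset].
exists (bool * bool)%type, (fun x => (x \in A, x \in B)),
  (fun k l => (k.1 && l.2)%:R); split.
  exact: (measurable_pair_label (mI _ mA) (mI _ mB)).
by apply/funext => -[x y]; rewrite indicE in_setX.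
Qed.

Definition step_approx (W : T * T -> R) : Prop :=
  measurable_fun [set: T * T] W /\ forall e : R, 0 < e ->
  exists2 S, is_step S & (L1dist (nu \x nu)%E W S <= e%:E)%E.

Lemma is_step_approx S : is_step S -> step_approx S.
Proof.
move=> sS; split; first exact: is_step_measurable.
move=> e e0; exists S => //; rewrite /L1dist.
under eq_integral do rewrite subrr normr0.
by rewrite integral0 lee_fin ltW.
Qed.

Lemma step_approx_map2 (op : R -> R -> R) (K : R) W1 W2 : 0 < K ->
  (forall a b a' b', `|op a b - op a' b'| <= K * (`|a - a'| + `|b - b'|)) ->
  step_approx W1 -> step_approx W2 ->
  measurable_fun [set: T * T] (fun z => op (W1 z) (W2 z)) ->
  step_approx (fun z => op (W1 z) (W2 z)).
Proof.
move=> K0 opL [mW1 aW1] [mW2 aW2] mop; split => // e e0.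
have e'0 : 0 < e / (2 * K) by rewrite divr_gt0// mulr_gt0.
have [S1 sS1 d1] := aW1 _ e'0; have [S2 sS2 d2] := aW2 _ e'0.
exists (fun z => op (S1 z) (S2 z)); first exact: is_step_map2.
apply: le_trans (L1dist_le _ mW1 (is_step_measurable sS1) mW2
  (is_step_measurable sS2) mop _ (ltW K0) _) _ => //.
  exact: (is_step_measurable (is_step_map2 op sS1 sS2)).
apply: (@le_trans _ _ (K%:E * ((e / (2 * K))%:E + (e / (2 * K))%:E))%E).
  by apply: lee_wpmul2l; [rewrite lee_fin ltW|exact: leeD].
by rewrite -EFinD -EFinM lee_fin; rewrite (_ : K * _ = e)//; field; rewrite gt_eqF.
Qed.

Lemma step_approx_lim W : measurable_fun [set: T * T] W ->
  (forall e : R, 0 < e ->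
     exists2 W', step_approx W' & (L1dist (nu \x nu)%E W W' <= e%:E)%E) ->
  step_approx W.
Proof.
move=> mW W_lim; split => // e e0.
have [|W' [mW' aW'] dW'] := W_lim (e / 2); first by rewrite divr_gt0.
have [|S sS dS] := aW' (e / 2); first by rewrite divr_gt0.
exists S => //; have mS := is_step_measurable sS.
apply: le_trans (L1dist_le _ mW mW' mW' mS mW mS ler01 _) _.
  by move=> x; rewrite mul1r (le_trans _ (ler_normD _ _))// addrA subrK.
rewrite mul1e; apply: le_trans (leeD dW' dS) _.
by rewrite -EFinD lee_fin; lra.
Qed.

Lemma step_approxD W1 W2 : step_approx W1 -> step_approx W2 ->
  step_approx (fun z => W1 z + W2 z).
Proof.
move=> a1 a2; apply: (@step_approx_map2 +%R 1) => //.
  by move=> a b a' b'; rewrite mul1r opprD addrACA ler_normD.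
by apply: measurable_funD; [case: a1|case: a2].
Qed.

Lemma step_approxZ c W : step_approx W -> step_approx (fun z => c * W z).
Proof.
move=> a; apply: (@step_approx_map2 (fun x _ => c * x) (`|c| + 1) W W) => //.
- move=> x b x' b'; rewrite -mulrBr normrM ler_pM//.
    by rewrite lerDl.
  by rewrite lerDl.
- by apply: measurable_funM => //; case: a.
Qed.

(** The sets with approximable indicator form a sigma-algebra containing the rectangles; countable
    unions are limits of finite ones. *)
Lemma step_approx_indic A : measurable A -> step_approx (\1_A).
Proof.
move=> mA.
pose G := [set A : set (T * T) | measurable A /\ step_approx (\1_A)].
suff : G A by case.
have G0 : G set0.
  split => //; rewrite (_ : \1_set0 = \1_(set0 `*` set0)); last by rewrite set0X.
  exact/is_step_approx/is_step_rect.
have GU A1 A2 : G A1 -> G A2 -> G (A1 `|` A2).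
  move=> [mA1 a1] [mA2 a2]; have mU : measurable (A1 `|` A2) by exact: measurableU.
  split => //.
  have -> : \1_(A1 `|` A2) = (fun z => \1_A1 z + \1_A2 z - \1_A1 z * \1_A2 z) :> (_ -> R).
    apply/funext => z; rewrite !indicE in_setU.
    by case: (z \in A1); case: (z \in A2) => /=; lra.
  (* On indicators a + b - ab equals the maximum, which unlike the polynomial is globally Lipschitz,
     as [step_approx_map2] requires. *)
  pose op (a b : R) := Num.max a b.
  have -> : (fun z => \1_A1 z + \1_A2 z - \1_A1 z * \1_A2 z) =
      (fun z => op (\1_A1 z) (\1_A2 z)).
    apply/funext => z; rewrite !indicE /op.
    by case: (z \in A1); case: (z \in A2) => /=;
      rewrite ?maxxx ?(max_l ler01) ?(max_r ler01); lra.
  apply: (@step_approx_map2 op 1) => //; last exact: measurable_maxr.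
  move=> a b a' b'; rewrite mul1r /op /Num.max.
  by do 2!case: ifPn => ?; rewrite ler_norml;
    move: (ler_norm (a - a')) (ler_norm (b - b'));
    move: (ler_norm (a' - a)) (ler_norm (b' - b)); rewrite (distrC a') (distrC b');
    move=> ? ? ? ?; apply/andP; split; lra.
have [_ GC GB] : sigma_algebra setT G.
  split => //.
  - move=> B [mB aB]; split; first exact: measurableD.
    have -> : \1_(setT `\` B) = (fun z => \1_(setT `*` setT) z + (-1) * \1_B z) :> (_ -> R).
      apply/funext => z; rewrite !indicE setTD in_setC setXTT in_setT.
      by case: (z \in B) => /=; lra.
    apply: step_approxD; first exact/is_step_approx/is_step_rect.
    exact: step_approxZ.
  - move=> B GB; have mB k : measurable (B k) by case: (GB k).
    have mU : measurable (\bigcup_k B k) by exact: bigcup_measurable.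
    split => //; apply: step_approx_lim => // e e0.
    have [k dk] := L1dist_bigcup (nu \x nu)%E mB e0.
    exists (\1_(\big[setU/set0]_(i < k) B i)) => //.
    suff : G (\big[setU/set0]_(i < k) B i) by case.
    by elim/big_ind: _ => // i _; exact: GB.
have : <<s [set A `*` B | A in @measurable _ T & B in @measurable _ T] >> `<=` G.
  apply: smallest_sub; first by split.
  move=> _ [B mB [C mC <-]]; split; first exact: measurableX.
  exact/is_step_approx/is_step_rect.
by rewrite -measurable_prod_measurableType => /(_ A); exact.
Qed.

Lemma step_approx_bounded (W : T * T -> R) (M : R) : measurable_fun [set: T * T] W ->
  (forall z, `|W z| <= M) -> step_approx W.
Proof.
move=> mW WM; apply: step_approx_lim => // e e0.
have iW : (nu \x nu)%E.-integrable setT (EFin \o W).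
  apply: measurable_bounded_integrable => //.
    by rewrite (le_lt_trans (probability_le1 _ _))// ltry.
  exists M; split; first exact: num_real.
  by move=> M' MM' x _; exact: le_trans (WM _) (ltW MM').
have [g [_ _ gW]] := approximation_sfun_integrable measurableT iW.
have /fine_cvgP[gfin /cvgrPdist_le/(_ e e0) ge] := gW.
near \oo => k.
exists (g k).
  have -> : (g k : _ -> R) = (fun z => \sum_(y <- finmap.enum_fset (fset_set (range (g k))))
      y * \1_(g k @^-1` [set y]) z).
    by apply/funext => z; rewrite fimfunE fsbig_finite.
  elim: (finmap.enum_fset _) => [|y s IH].
    under eq_fun do rewrite big_nil.
    have := step_approx_indic (@measurable0 _ (T * T)%type).
    by rewrite indic0.
  under eq_fun do rewrite big_cons.
  apply: step_approxD => //; apply: step_approxZ; apply: step_approx_indic.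
  by rewrite -[X in measurable X]setTI; exact: measurable_funP.
have kfin : (\int[(nu \x nu)%E]_z `|(W z)%:E - (g k z)%:E| \is a fin_num)%E.
  by near: k.
rewrite /L1dist; under eq_integral do rewrite -abse_EFin EFinB.
rewrite -(fineK kfin) lee_fin.
have : `|0 - fine (\int[(nu \x nu)%E]_z `|(W z)%:E - (g k z)%:E|)%E| <= e by near: k.
by rewrite sub0r normrN; apply: le_trans (ler_norm _).
Unshelve. all: by end_near.
Qed.

End step_approximation.

(** Telescoping: the factors are exchanged one at a time. *)
Lemma normr_prodB_le {R : realDomainType} (I : eqType) (s : seq I) (a b : I -> R) (M : R) :
  1 <= M -> (forall i, `|a i| <= M) -> (forall i, `|b i| <= M) ->
  `|\prod_(i <- s) a i - \prod_(i <- s) b i| <=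
  M ^+ size s * \sum_(i <- s) `|a i - b i|.
Proof.
move=> M1 aM bM; have M0 : 0 <= M := le_trans ler01 M1.
elim: s => [|i s IH]; first by rewrite !big_nil subrr normr0 mulr0.
rewrite !big_cons /= exprS.
set A := \prod_(j <- s) a j in IH *; set B := \prod_(j <- s) b j in IH *.
set D := \sum_(j <- s) _ in IH *.
have BM : `|B| <= M ^+ size s.
  rewrite /B; elim: (s) => [|j t IHt]; first by rewrite big_nil normr1.
  by rewrite big_cons normrM exprS ler_pM.
have -> : a i * A - b i * B = a i * (A - B) + (a i - b i) * B by ring.
rewrite (le_trans (ler_normD _ _))// !normrM [in leRHS]mulrDr addrC.
have Ms : 0 <= M ^+ size s by exact: exprn_ge0.
apply: lerD.
  rewrite mulrC ler_wpM2r// (le_trans BM)//.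
  by rewrite ler_peMl.
by rewrite -mulrA ler_pM.
Qed.

(** * Continuity of densities in L1 for bounded kernels *)

Section hom_density_continuity.
Context {R : realType} {d : measure_display} {T : measurableType d}.
Variable nu : probability T R.
Context {n : nat}.

Lemma measurable_tnth_pair (i j : 'I_n) :
  measurable_fun [set: n.-tuple T] (fun x => (tnth x i, tnth x j)).
Proof. by apply: measurable_fun_pair; exact: measurable_tnth. Qed.

(** By uniqueness of the product measure it suffices to test rectangles, whose preimages are boxes
    with full sides in the other coordinates. *)
Lemma power_measure_pair (i j : 'I_n) (A : set (T * T)) : i != j -> measurable A ->
  power_measure nu n ((fun x => (tnth x i, tnth x j)) @^-1` A) = (nu \x nu)%E A.
Proof.
move=> ij mA.
pose phi : {mfun n.-tuple T >-> (T * T)%type} :=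
  HB.pack (fun x : n.-tuple T => (tnth x i, tnth x j))
    (isMeasurableFun.Build _ _ _ _ _ (measurable_tnth_pair i j)).
rewrite (@product_measure_unique _ _ _ _ _ nu nu
  (pushforward (power_measure nu n) phi))// => B C mB mC.
pose D k := if k == i then B else if k == j then C else setT.
transitivity (power_measure nu n [set x | forall k, D k (tnth x k)]).
  congr (power_measure nu n _); apply/seteqP; split => x /= => [[Bx Cx] k|Dx].
    by rewrite /D; case: eqP => [->//|_]; case: eqP => [->|].
  by split; [have := Dx i|have := Dx j]; rewrite /D ?eqxx// eq_sym (negbTE ij).
rewrite power_measure_box; last by move=> k; rewrite /D; do 2!case: ifP => // _.
rewrite (bigD1 i)//= (bigD1 j) /=; last by rewrite eq_sym.
rewrite big1 ?mule1 => [|k /andP[ki kj]]; last first.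
  by rewrite /D (negbTE ki) (negbTE kj) probability_setT.
by rewrite /D eqxx eq_sym (negbTE ij) eqxx.
Qed.

Lemma integral_tnth_pair (i j : 'I_n) (h : T * T -> R) : i != j ->
  measurable_fun [set: T * T] h -> (forall z, 0 <= h z) ->
  (\int[power_measure nu n]_x (h (tnth x i, tnth x j))%:E =
   \int[nu \x nu]_z (h z)%:E)%E.
Proof.
move=> ij mh h0; have mphi := measurable_tnth_pair i j.
transitivity (\int[pushforward (power_measure nu n)
  (fun x : n.-tuple T => (tnth x i, tnth x j))]_z (h z)%:E)%E.
  rewrite (ge0_integral_pushforward mphi)//; first exact/measurable_EFinP.
  by move=> z _; rewrite lee_fin.
by apply: eq_measure_integral => A mA _; exact: power_measure_pair.
Qed.

Variable E : rel 'I_n.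

Lemma measurable_hom_integrand (W : T * T -> R) :
  measurable_fun [set: T * T] W ->
  measurable_fun [set: n.-tuple T] (hom_integrand E W).
Proof.
move=> mW; rewrite /hom_integrand; under eq_fun do rewrite -big_enum.
apply: measurable_prod => e _.
exact: (measurableT_comp mW (measurable_tnth_pair e.1 e.2)).
Qed.

Lemma hom_integrand_integrable (W : T * T -> R) (M : R) :
  measurable_fun [set: T * T] W -> (forall z, `|W z| <= M) ->
  (power_measure nu n).-integrable [set: n.-tuple T] (EFin \o hom_integrand E W).
Proof.
move=> mW WM; apply: measurable_bounded_integrable => //.
- by rewrite (le_lt_trans (probability_le1 _ _))// ltry.
- exact: measurable_hom_integrand.
- exists (M ^+ #|edges E|); split; first exact: num_real.
  move=> M' MM' x _; apply: (le_trans _ (ltW MM')) => /=.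
  rewrite /hom_integrand normr_prod -prodr_const.
  by apply: ler_prod => e _; rewrite normr_ge0 WM.
Qed.

(** Telescoping leaves one difference per edge, and each depends on two distinct coordinates only,
    so it integrates to the L1 distance. *)
Lemma hom_density_lipschitz (W S : T * T -> R) (M : R) :
  measurable_fun [set: T * T] W -> measurable_fun [set: T * T] S ->
  1 <= M -> (forall z, `|W z| <= M) -> (forall z, `|S z| <= M) ->
  ((`|hom_density nu E W - hom_density nu E S|)%:E <=
   (M ^+ #|edges E| * #|edges E|%:R)%:E * L1dist (nu \x nu) W S)%E.
Proof.
move=> mW mS M1 WM SM.
have iW := hom_integrand_integrable mW WM; have iS := hom_integrand_integrable mS SM.
have M0 : 0 <= M ^+ #|edges E| by rewrite exprn_ge0// (le_trans ler01).
rewrite /hom_density -RintegralB//.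
have mB : measurable_fun [set: n.-tuple T]
    (fun x => hom_integrand E W x - hom_integrand E S x).
  by apply: measurable_funB; exact: measurable_hom_integrand.
have mh (e : 'I_n * 'I_n) : measurable_fun [set: n.-tuple T]
    (fun x => `|W (tnth x e.1, tnth x e.2) - S (tnth x e.1, tnth x e.2)|).
  apply: measurableT_comp => //; apply: measurable_funB.
    exact: (measurableT_comp mW (measurable_tnth_pair e.1 e.2)).
  exact: (measurableT_comp mS (measurable_tnth_pair e.1 e.2)).
rewrite EFin_normr_Rintegral//; last first.
  by rewrite (_ : _ \o _ = (EFin \o hom_integrand E W) \- (EFin \o hom_integrand E S))%E//;
    exact: integrableB.
apply: le_trans (le_abse_integral _ _ _) _ => //; first exact/measurable_EFinP.
pose h (e : 'I_n * 'I_n) (x : n.-tuple T) : \bar R :=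
  (`|W (tnth x e.1, tnth x e.2) - S (tnth x e.1, tnth x e.2)|)%:E.
have mhE e : measurable_fun [set: n.-tuple T] (h e).
  by apply/measurable_EFinP; exact: mh.
apply: (@le_trans _ _ (\int[power_measure nu n]_x
    ((M ^+ #|edges E|)%:E * \sum_(e <- enum (edges E)) h e x))%E).
  apply: ge0_le_integral => //.
  - by apply/measurable_EFinP; apply: measurableT_comp.
  - apply: measurable_funeM; apply: emeasurable_sum => e.
    exact: mhE.
  - move=> x _; rewrite /h sumEFin -EFinM lee_fin /hom_integrand.
    rewrite -!big_enum/= cardE; apply: normr_prodB_le => // e; exact: WM || exact: SM.
rewrite ge0_integralZl_EFin//; first last.
- by apply: emeasurable_sum => e; exact: mhE.
- by move=> x _; apply: sume_ge0 => e _; rewrite lee_fin.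
rewrite ge0_integral_sum//; last by move=> e x _; rewrite lee_fin.
rewrite EFinM -muleA lee_wpmul2l ?lee_fin// cardE.
have dist_ge0 : (0 <= L1dist (nu \x nu) W S)%E by exact: integral_ge0.
have -> : ((size (enum (edges E)))%:R%:E * L1dist (nu \x nu) W S =
    \sum_(e <- enum (edges E)) L1dist (nu \x nu) W S)%E.
  elim: (enum _) => [|e s IH]; first by rewrite big_nil mul0e.
  by rewrite big_cons -IH /= mulrS EFinD ge0_muleDl ?lee_fin// mul1e.
rewrite 2!big_seq; apply: lee_sum => e; rewrite mem_enum inE => /andP[e12 _].
rewrite /h (integral_tnth_pair (i := e.1) (j := e.2)
  (h := fun z => `|W z - S z|))//; first by rewrite neq_ltn e12.
by apply: measurableT_comp => //; exact: measurable_funB.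
Qed.

Lemma hom_density_cvg (W : T * T -> R) (S : (T * T -> R)^nat) (M : R) :
  measurable_fun [set: T * T] W -> (forall k, measurable_fun [set: T * T] (S k)) ->
  (forall z, `|W z| <= M) -> (forall k z, `|S k z| <= M) ->
  (forall k, (L1dist (nu \x nu) W (S k) <= (k.+1%:R^-1)%:E)%E) ->
  hom_density nu E (S k) @[k --> \oo] --> hom_density nu E W.
Proof.
move=> mW mS WM SM WS.
pose M' := Num.max 1 M; have M'1 : 1 <= M' by rewrite le_max lexx.
have MM' : M <= M' by rewrite le_max lexx orbT.
pose C := M' ^+ #|edges E| * #|edges E|%:R.
have C0 : 0 <= C by rewrite mulr_ge0// exprn_ge0// (le_trans ler01).
have WSk k : `|hom_density nu E W - hom_density nu E (S k)| <= C / k.+1%:R.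
  rewrite -lee_fin; apply: le_trans (hom_density_lipschitz mW (mS k) M'1 _ _) _.
  - by move=> z; exact: le_trans MM'.
  - by move=> z; exact: le_trans MM'.
  - by rewrite [X in (_ <= X)%E]EFinM; apply: lee_wpmul2l; rewrite ?lee_fin.
apply/cvgrPdist_le => e e0.
have C_cvg : C / k.+1%:R @[k --> \oo] --> C * 0.
  by apply: cvgM; [exact: cvg_cst|exact: cvg_harmonic].
move: C_cvg; rewrite mulr0 => /cvgrPdist_le/(_ e e0); apply: filterS => k.
rewrite sub0r normrN => Ck; apply: le_trans (WSk k) _.
exact: le_trans (ler_norm _) Ck.
Qed.

End hom_density_continuity.

Lemma cvg_powR {R : realType} (u : R^nat) (l p : R) : 0 < p ->
  (forall k, 0 <= u k) -> u @ \oo --> l -> u k `^ p @[k --> \oo] --> l `^ p.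
Proof.
move=> p0 u0 ul.
have l0 : 0 <= l.
  rewrite -(cvg_lim _ ul)//; apply: limr_ge; first by apply/cvg_ex; exists l.
  exact: nearW.
(* The power function is differentiable at positive points only; at 0 the bound u < e^(1/p) is used
   directly. *)
move: l0; rewrite le_eqVlt => /orP[/eqP l0|l0].
  rewrite -l0 powR0 ?gt_eqF//; apply/cvgrPdist_lt => e e0.
  move: ul; rewrite -l0 => /cvgrPdist_lt/(_ _ (powR_gt0 p^-1 e0)).
  apply: filterS => k; rewrite !sub0r !normrN ger0_norm// ger0_norm ?powR_ge0// => uk.
  have := gt0_ltr_powR p0 (u0 k) (powR_ge0 _ _) uk.
  by rewrite -powRrM mulVf ?gt_eqF// powRr1// ltW.
apply: (cvg_comp u (fun x => x `^ p) ul).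
have : differentiable (fun x : R => x `^ p) l.
  by apply/derivable1_diffP; apply: derivable_powR; rewrite in_itv/= l0.
exact: differentiable_continuous.
Qed.

Definition clamp {R : realType} (M x : R) : R := Num.max (- M) (Num.min M x).

Section clamp.
Context {R : realType}.
Implicit Types M x : R.

Lemma clamp_norm_le M x : 0 <= M -> `|clamp M x| <= M.
Proof.
by move=> M0; rewrite /clamp ler_norml le_max lexx/= ge_max ge_min lexx/= andbT; lra.
Qed.

Lemma clamp_norm_le_id M x : 0 <= M -> `|clamp M x| <= `|x|.
Proof.
move=> M0; have := ler_norm x; have := ler_norm (- x); rewrite normrN => ? ?.
rewrite /clamp; case: (ltP (Num.min M x) (- M)); case: (ltP M x) => ? ?;
  by rewrite ler_norml; apply/andP; split; lra.
Qed.

Lemma clamp_id M x : `|x| <= M -> clamp M x = x.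
Proof.
rewrite ler_norml => /andP[Mx xM]; rewrite /clamp min_r// max_r//.
Qed.

Lemma clamp_lipschitz M x y : `|x| <= M -> `|x - clamp M y| <= `|x - y|.
Proof.
rewrite ler_norml => /andP[Mx xM].
have := ler_norm (x - y); have := ler_norm (y - x); rewrite (distrC y).
rewrite /clamp; case: (ltP (Num.min M y) (- M)); case: (ltP M y) => ? ? ? ?;
  by rewrite ler_norml; apply/andP; split; lra.
Qed.

Lemma measurable_clamp d (X : measurableType d) M (f : X -> R) :
  measurable_fun [set: X] f -> measurable_fun [set: X] (fun z => clamp M (f z)).
Proof.
by move=> mf; apply: measurable_maxr => //; exact: measurable_minr.
Qed.

End clamp.

Section symmetric_steps.
Context {R : realType} {d : measure_display} {T : measurableType d}.
Variable nu : probability T R.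

(** In the square of the space, both ordered pairs of distinct coordinates have law [nu \x nu]. *)
Lemma integral_swap (h : T * T -> R) :
  measurable_fun [set: T * T] h -> (forall z, 0 <= h z) ->
  (\int[nu \x nu]_z (h (z.2, z.1))%:E = \int[nu \x nu]_z (h z)%:E)%E.
Proof.
move=> mh h0.
have i01 : (0 : 'I_2) != 1 by []; have i10 : (1 : 'I_2) != 0 by [].
rewrite -(integral_tnth_pair nu i10 mh h0).
rewrite -(integral_tnth_pair nu i01 (h := fun z => h (z.2, z.1)))//.
apply: (measurableT_comp mh); apply: measurable_fun_pair.
  exact: measurable_snd.
exact: measurable_fst.
Qed.

(** Symmetry and bound are imposed on the matrix [w], also at labels of measure 0, because the
    finite inequalities are about matrices. *)
Definition is_symmetric_step (M : R) (S : T * T -> R) : Prop :=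
  exists (I : finType) (f : T -> I) (w : I -> I -> R),
    [/\ forall i, measurable (f @^-1` [set i]), forall i j, w i j = w j i,
        forall i j, `|w i j| <= M & S = step_kernel f w].

(** Averaging an approximant with its transpose and clamping it to [-M, M] does not increase its
    distance to a symmetric kernel bounded by [M]. *)
Lemma symmetric_step_approx (W : T * T -> R) (M e : R) :
  measurable_fun [set: T * T] W -> (forall x y, W (x, y) = W (y, x)) ->
  0 <= M -> (forall z, `|W z| <= M) -> 0 < e ->
  exists2 S, is_symmetric_step M S & (L1dist (nu \x nu) W S <= e%:E)%E.
Proof.
move=> mW WC M0 WM e0.
have [_ /(_ e e0)[S [I [f [w [mf ->]]]] dS]] := step_approx_bounded nu mW WM.
pose w' i j := clamp M (2^-1 * (w i j + w j i)).
exists (step_kernel f w').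
  exists I, f, w'; split => //.
  - by move=> i j; rewrite /w' addrC.
  - by move=> i j; exact: clamp_norm_le.
have mswap (h : T * T -> R) : measurable_fun [set: T * T] h ->
    measurable_fun [set: T * T] (fun z => h (z.2, z.1)).
  move=> mh; apply: (measurableT_comp mh); apply: measurable_fun_pair.
    exact: measurable_snd.
  exact: measurable_fst.
have mS := measurable_step_kernel mf w.
apply: le_trans (L1dist_le (K := 2^-1) _ mW mS (mswap _ mW) (mswap _ mS) mW
  (measurable_step_kernel mf w') _ _) _ => //.
  move=> [x y] /=; rewrite (WC y x); rewrite /step_kernel/= /w'.
  apply: le_trans (clamp_lipschitz _ (WM _)) _.
  have -> : W (x, y) - 2^-1 * (w (f x) (f y) + w (f y) (f x)) =
    2^-1 * (W (x, y) - w (f x) (f y)) + 2^-1 * (W (x, y) - w (f y) (f x)) by field.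
  rewrite (le_trans (ler_normD _ _))// !normrM mulrDr (@ger0_norm _ 2^-1)// invr_ge0.
have -> : (L1dist (nu \x nu) (fun z => W (z.2, z.1))
    (fun z => step_kernel f w (z.2, z.1)) =
    L1dist (nu \x nu) W (step_kernel f w))%E.
  apply: (integral_swap (h := fun z => `|W z - step_kernel f w z|)) => //.
  by apply: measurableT_comp => //; exact: measurable_funB.
apply: (@le_trans _ _ ((2^-1)%:E * (e%:E + e%:E))%E).
  by apply: lee_wpmul2l; [rewrite lee_fin|exact: leeD].
by rewrite -EFinD -EFinM lee_fin; lra.
Qed.

End symmetric_steps.

(** * Hanner's inequality for the graph norm *)

(** Used for even [m], where the last power needs no absolute value. *)
Definition hanner_le {R : realType} {U : zmodType} (N : U -> R) (m : nat) (x y : U) : Prop :=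
  N (x + y) ^+ m + N (x - y) ^+ m <= (N x + N y) ^+ m + (N x - N y) ^+ m.

Section graph_norm_hanner.
Context {R : realType} {d : measure_display} {T : measurableType d}.
Variable nu : probability T R.
Hypothesis nu_atomless : atomless nu.
Context {n : nat} (E : rel 'I_n).
Hypothesis E_sym : symmetric E.
Hypothesis E_norm : seminorming nu E.
Variable v0 : 'I_n.
Let K := edges_in E (component E v0).
Hypothesis K_gt0 : (0 < #|K|)%N.
Hypothesis K_even : ~~ odd #|K|.

Let N := graph_norm nu E.
Let hanner := hanner_le N #|K|.

Lemma sum_label_law (I : finType) (f : T -> I) :
  (forall i, measurable (f @^-1` [set i])) ->
  \sum_i fine (nu (f @^-1` [set i])) = 1.
Proof.
move=> mf; have := Rintegral_finite_range mf nu (fun=> 1).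
rewrite Rintegral_cst// [X in _ * fine X = _]probability_setT mulr1 => ->.
by apply: eq_bigr => i _; rewrite mul1r.
Qed.

(** The pair of labels is a common labelling, over which both kernels become matrices. *)
Lemma hanner_step M M' S S' : is_symmetric_step M S -> is_symmetric_step M' S' ->
  hanner S S'.
Proof.
move=> [I [f [w [mf wC _ ->]]]] [J [g [u [mg uC _ ->]]]].
pose h x := (f x, g x).
have mh := measurable_pair_label mf mg : forall k, measurable (h @^-1` [set k]).
pose p k := fine (nu (h @^-1` [set k])).
have nup k : nu (h @^-1` [set k]) = (p k)%:E.
  by rewrite /p fineK ?fin_num_measure.
pose w' (k l : I * J) := w k.1 l.1; pose u' (k l : I * J) := u k.2 l.2.
have Nh v : N (step_kernel h v) = density_norm (edges E) p v.
  exact: graph_norm_step.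
have p0 k : 0 <= p k by exact: fine_ge0.
have := density_hanner (edges_gt0 K_gt0)
  (seminorming_density_norm_sum nu_atomless E_norm)
  (edges_in_sub E v0) K_gt0 (@edges_inP _ E v0) (@edges_notinP _ E E_sym v0)
  K_even p0 (sum_label_law mh)
  (x := w') (y := u') (fun k l => wC k.1 l.1) (fun k l => uC k.2 l.2).
by rewrite -!Nh.
Qed.

Lemma hanner_cvg (x y : T * T -> R) (x_ y_ : (T * T -> R)^nat) :
  (forall k, hanner (x_ k) (y_ k)) ->
  hom_density nu E (x_ k) @[k --> \oo] --> hom_density nu E x ->
  hom_density nu E (y_ k) @[k --> \oo] --> hom_density nu E y ->
  hom_density nu E (x_ k + y_ k) @[k --> \oo] --> hom_density nu E (x + y) ->
  hom_density nu E (x_ k - y_ k) @[k --> \oo] --> hom_density nu E (x - y) ->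
  hanner x y.
Proof.
move=> hk cx cy cD cB.
have Ncvg (W : T * T -> R) (W_ : (T * T -> R)^nat) :
    hom_density nu E (W_ k) @[k --> \oo] --> hom_density nu E W ->
    N (W_ k) @[k --> \oo] --> N W.
  move=> cW; apply: cvg_powR => //; last exact: cvg_norm.
  by rewrite invr_gt0 ltr0n (edges_gt0 K_gt0).
have Xcvg (a_ : R^nat) (a : R) : a_ k @[k --> \oo] --> a ->
    a_ k ^+ #|K| @[k --> \oo] --> a ^+ #|K|.
  by move=> ca; apply: (cvg_comp a_ (fun b => b ^+ #|K|) ca); exact: exprn_continuous.
have lhs : N (x_ k + y_ k) ^+ #|K| + N (x_ k - y_ k) ^+ #|K| @[k --> \oo] -->
    N (x + y) ^+ #|K| + N (x - y) ^+ #|K|.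
  by apply: cvgD; [exact: Xcvg (Ncvg _ _ cD)|exact: Xcvg (Ncvg _ _ cB)].
have rhs : (N (x_ k) + N (y_ k)) ^+ #|K| + (N (x_ k) - N (y_ k)) ^+ #|K| @[k --> \oo]
    --> (N x + N y) ^+ #|K| + (N x - N y) ^+ #|K|.
  apply: cvgD.
    exact: Xcvg (cvgD (Ncvg _ _ cx) (Ncvg _ _ cy)).
  exact: Xcvg (cvgB (Ncvg _ _ cx) (Ncvg _ _ cy)).
by apply: (ler_cvg_to lhs rhs); apply: nearW => k; exact: hk.
Qed.

Lemma hanner_bounded (x y : T * T -> R) (M : R) :
  measurable_fun [set: T * T] x -> measurable_fun [set: T * T] y ->
  (forall s t, x (s, t) = x (t, s)) -> (forall s t, y (s, t) = y (t, s)) ->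
  0 <= M -> (forall z, `|x z| <= M) -> (forall z, `|y z| <= M) -> hanner x y.
Proof.
move=> mx my xC yC M0 xM yM.
(* Half of 1/(k+1), since the errors of [x_ k] and [y_ k] add up in their sum and difference. *)
pose e k : R := (2 * k.+1%:R)^-1.
have e0 k : 0 < e k by rewrite invr_gt0 mulr_gt0.
have ex k : exists S, is_symmetric_step M S /\ (L1dist (nu \x nu) x S <= (e k)%:E)%E.
  by have [S] := symmetric_step_approx nu mx xC M0 xM (e0 k); exists S.
have ey k : exists S, is_symmetric_step M S /\ (L1dist (nu \x nu) y S <= (e k)%:E)%E.
  by have [S] := symmetric_step_approx nu my yC M0 yM (e0 k); exists S.
have [x_ x_P] := choice ex; have [y_ y_P] := choice ey.
have step_m (S : T * T -> R) : is_symmetric_step M S -> measurable_fun [set: T * T] S.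
  by move=> [I [f [w [mf _ _ ->]]]]; exact: measurable_step_kernel.
have step_M (S : T * T -> R) : is_symmetric_step M S -> forall z, `|S z| <= M.
  by move=> [I [f [w [_ _ wM ->]]]] z; exact: wM.
have mx_ k := step_m _ (x_P k).1; have my_ k := step_m _ (y_P k).1.
have xM_ k := step_M _ (x_P k).1; have yM_ k := step_M _ (y_P k).1.
have e_le k : e k <= k.+1%:R^-1.
  by rewrite lef_pV2 ?posrE// ?mulr_gt0// ler_peMl// ler1n.
have dsum (s : R) k : `|s| = 1 ->
    (L1dist (nu \x nu) (fun z => (x z + s * y z)%R) (fun z => x_ k z + s * y_ k z)%R <=
     (k.+1%:R^-1)%:E)%E.
  move=> s1; apply: le_trans (L1dist_le _ mx (mx_ k) my (my_ k) _ _ ler01 _) _.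
  - by apply: measurable_funD => //; exact: measurable_funM.
  - by apply: measurable_funD => //; exact: measurable_funM.
  - move=> z; rewrite mul1r.
    have -> : x z + s * y z - (x_ k z + s * y_ k z) =
      (x z - x_ k z) + s * (y z - y_ k z) by ring.
    by rewrite (le_trans (ler_normD _ _))// normrM s1 mul1r.
  - rewrite mul1e (le_trans (leeD (x_P k).2 (y_P k).2))// -EFinD lee_fin.
    have -> : e k = 2^-1 * k.+1%:R^-1 by rewrite /e invfM.
    by rewrite -mulrDl (_ : 2^-1 + 2^-1 = 1 :> R) ?mul1r//; lra.
have cvg2 (s : R) : `|s| = 1 ->
    hom_density nu E (fun z => x_ k z + s * y_ k z) @[k --> \oo] -->
    hom_density nu E (fun z => x z + s * y z).
  move=> s1; apply: (hom_density_cvg (M := M + M)).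
  - by apply: measurable_funD => //; exact: measurable_funM.
  - by move=> k; apply: measurable_funD => //; exact: measurable_funM.
  - by move=> z; rewrite (le_trans (ler_normD _ _))// normrM s1 mul1r lerD.
  - by move=> k z; rewrite (le_trans (ler_normD _ _))// normrM s1 mul1r lerD.
  - by move=> k; exact: dsum.
apply: (@hanner_cvg x y x_ y_).
- by move=> k; exact: hanner_step (x_P k).1 (y_P k).1.
- apply: (hom_density_cvg (M := M)) => // k.
  by apply: le_trans (x_P k).2 _; rewrite lee_fin.
- apply: (hom_density_cvg (M := M)) => // k.
  by apply: le_trans (y_P k).2 _; rewrite lee_fin.
- have := cvg2 1 (normr1 _).
  have fE (a b : T * T -> R) : (fun z => a z + 1 * b z) = a + b.
    by apply/funext => z; rewrite mul1r.
  by under eq_fun do rewrite fE; rewrite fE.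
- have := cvg2 (-1) (normrN1 _).
  have fE (a b : T * T -> R) : (fun z => a z + (-1) * b z) = a - b.
    by apply/funext => z; rewrite mulN1r.
  by under eq_fun do rewrite fE; rewrite fE.
Qed.

Lemma hom_density_dominated_cvg (W : T * T -> R) (W_ : (T * T -> R)^nat) (G : T * T -> R) :
  measurable_fun [set: T * T] W -> (forall k, measurable_fun [set: T * T] (W_ k)) ->
  (power_measure nu n).-integrable [set: n.-tuple T] (EFin \o hom_integrand E G) ->
  (forall k z, `|W_ k z| <= G z) -> (forall z, W_ k z @[k --> \oo] --> W z) ->
  hom_density nu E (W_ k) @[k --> \oo] --> hom_density nu E W.
Proof.
move=> mW mW_ iG WG W_W.
have mh (V : T * T -> R) : measurable_fun [set: T * T] V ->
    measurable_fun [set: n.-tuple T] (EFin \o hom_integrand E V).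
  by move=> mV; apply/measurable_EFinP; exact: measurable_hom_integrand.
have hcvg x : (EFin \o hom_integrand E (W_ k)) x @[k --> \oo] -->
    (EFin \o hom_integrand E W) x.
  apply: cvg_EFin; first exact: nearW.
  have prod_cvg (s : seq ('I_n * 'I_n)) :
      \prod_(e <- s) W_ k (tnth x e.1, tnth x e.2) @[k --> \oo] -->
      \prod_(e <- s) W (tnth x e.1, tnth x e.2).
    elim: s => [|e s IH].
      by under eq_fun do rewrite big_nil; rewrite big_nil; exact: cvg_cst.
    by under eq_fun do rewrite big_cons; rewrite big_cons; exact: cvgM.
  have homE (V : T * T -> R) : hom_integrand E V x =
    \prod_(e <- enum (edges E)) V (tnth x e.1, tnth x e.2) by rewrite big_enum.
  by rewrite /comp/= homE; under eq_fun do rewrite homE; exact: prod_cvg.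
have hle k x : (`|(EFin \o hom_integrand E (W_ k)) x| <=
    (EFin \o hom_integrand E G) x)%E.
  rewrite /= lee_fin /hom_integrand normr_prod.
  by apply: ler_prod => e _; rewrite normr_ge0 WG.
have [iW _ cvgW] := @dominated_convergence _ _ _ (power_measure nu n) _ measurableT
  (fun k => EFin \o hom_integrand E (W_ k)) (EFin \o hom_integrand E W)
  (EFin \o hom_integrand E G) (fun k => mh _ (mW_ k)) (mh _ mW)
  (aeW _ (fun x _ => hcvg x)) iG (aeW _ (fun x k _ => hle k x)).
apply: fine_cvg; rewrite fineK; first exact: cvgW.
exact: integrable_fin_num.
Qed.

Lemma kernel_space_norm W : kernel_space nu E W -> kernel_space nu E (fun z => `|W z|).
Proof.
move=> [mW WC iW]; split.
- exact: measurableT_comp.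
- by move=> x y; rewrite WC.
- rewrite (_ : _ \o _ = abse \o (EFin \o hom_integrand E W)); first exact: integrable_abse.
  by apply/funext => x; rewrite /= /hom_integrand normr_prod.
Qed.

(** Truncations at level k satisfy the inequality by [hanner_bounded]; one majorant [G] gives
    convergence of all four densities. *)
Theorem kernel_space_hanner x y :
  kernel_space nu E x -> kernel_space nu E y -> hanner x y.
Proof.
move=> Vx Vy; have [mx xC ix] := Vx; have [my yC iy] := Vy.
have [[_ VD _] _ _ _] := E_norm.
pose G : T * T -> R := (fun z => `|x z|) + (fun z => `|y z|).
have GE z : G z = `|x z| + `|y z| by [].
have [_ _ iG] : kernel_space nu E G by apply: VD; exact: kernel_space_norm.
pose tr (W : T * T -> R) (k : nat) z := clamp k%:R (W z).
have tr_cvg W z : tr W k z @[k --> \oo] --> W z.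
  apply: cvg_near_cst; near=> k; rewrite /tr clamp_id//.
  near: k; exists (Num.truncn `|W z|).+1 => // k /= Wk.
  by rewrite (le_trans (ltW (truncnS_gt _)))// ler_nat.
have tr_m W k : measurable_fun [set: T * T] W -> measurable_fun [set: T * T] (tr W k).
  exact: measurable_clamp.
have tr_le W k z : `|tr W k z| <= `|W z| by exact: clamp_norm_le_id.
apply: (@hanner_cvg x y (tr x) (tr y)).
- move=> k; apply: (hanner_bounded (M := k%:R)) => //.
  + exact: tr_m.
  + exact: tr_m.
  + by move=> s t; rewrite /tr xC.
  + by move=> s t; rewrite /tr yC.
  + by move=> z; exact: clamp_norm_le.
  + by move=> z; exact: clamp_norm_le.
- apply: (hom_density_dominated_cvg mx _ iG) => //.
  + by move=> k; exact: tr_m.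
  + by move=> k z; rewrite GE (le_trans (tr_le _ _ _))// lerDl.
- apply: (hom_density_dominated_cvg my _ iG) => //.
  + by move=> k; exact: tr_m.
  + by move=> k z; rewrite GE (le_trans (tr_le _ _ _))// lerDr.
- apply: (hom_density_dominated_cvg _ _ iG).
  + exact: measurable_funD.
  + by move=> k; apply: measurable_funD; exact: tr_m.
  + by move=> k z; rewrite GE (le_trans (ler_normD _ _))// lerD.
  + by move=> z; apply: cvgD; exact: tr_cvg.
- apply: (hom_density_dominated_cvg _ _ iG).
  + exact: measurable_funB.
  + by move=> k; apply: measurable_funB; exact: tr_m.
  + by move=> k z; rewrite GE (le_trans (ler_normB _ _))// lerD.
  + by move=> z; apply: cvgB; exact: tr_cvg.
Unshelve. all: by end_near.
Qed.

End graph_norm_hanner.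

(** * Moduli of convexity and smoothness *)

(** The induction step is Chebyshev's inequality: s - t and s^m - t^m have the same sign. *)
Lemma expr_mean_le {R : realFieldType} (s t : R) m : 0 <= s -> 0 <= t ->
  (2^-1 * (s + t)) ^+ m <= 2^-1 * (s ^+ m + t ^+ m).
Proof.
move=> s0 t0; elim: m => [|m IH]; first by rewrite !expr0; lra.
have : 0 <= (s - t) * (s ^+ m - t ^+ m).
  have [st|ts] := leP s t.
    by rewrite mulr_le0// subr_le0// lerXn2r.
  by rewrite mulr_ge0// subr_ge0 ?lerXn2r// ltW.
have st0 : 0 <= 2^-1 * (s + t) by lra.
have := ler_wpM2l st0 IH.
rewrite !exprS; move: (s ^+ m) (t ^+ m) ((2^-1 * (s + t)) ^+ m) => a b c; nra.
Qed.

Lemma powR_invX {R : realType} (x : R) m : (0 < m)%N -> 0 <= x ->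
  (x `^ m%:R^-1) ^+ m = x.
Proof.
move=> m0 x0; rewrite -powR_mulrn ?powR_ge0// -powRrM mulVf ?powRr1//.
by rewrite pnatr_eq0 -lt0n.
Qed.

Lemma exprn_inj {R : realDomainType} m (x y : R) : (0 < m)%N -> 0 <= x -> 0 <= y ->
  x ^+ m = y ^+ m -> x = y.
Proof. by move=> m0 x0 y0 /eqP; rewrite eqrXn2// => /eqP. Qed.

(** * Both moduli from Hanner's inequality and a copy of l^m_2 *)

Section moduli.
Context {R : realType} {U : lmodType R}.
(** Applied both to W_H and to l^m. The assumptions are only what the computations use, so that they
    can be checked for [lnorm] without Minkowski's inequality. *)
Variables (V : set U) (N : U -> R) (m : nat).
Hypothesis m_gt0 : (0 < m)%N.
Hypothesis N_ge0 : forall x, 0 <= N x.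
Hypothesis N_half : forall x y, V x -> V y -> N (2^-1 *: (x + y)) = 2^-1 * N (x + y).
Variables u v : U.
Hypothesis V_uv : forall a b : R, V (a *: u + b *: v).
Hypothesis N_uv : forall a b : R, N (a *: u + b *: v) ^+ m = `|a| ^+ m + `|b| ^+ m.

Let N_uvE (a b c : R) : 0 <= c -> `|a| ^+ m + `|b| ^+ m = c ^+ m ->
  N (a *: u + b *: v) = c.
Proof. by move=> c0 abc; apply: (exprn_inj m_gt0) => //; rewrite N_uv. Qed.

Let uvD (a b a' b' : R) :
  (a *: u + b *: v) + (a' *: u + b' *: v) = (a + a') *: u + (b + b') *: v.
Proof. by rewrite addrACA -!scalerDl. Qed.

Let uvB (a b a' b' : R) :
  (a *: u + b *: v) - (a' *: u + b' *: v) = (a - a') *: u + (b - b') *: v.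
Proof. by rewrite opprD addrACA -!scalerBl. Qed.

(** In l^1_2 the unit vectors are at distance 2 and their midpoint still has norm 1. *)
Lemma modulus_convexity_le0 (e : R) : m = 1%N -> e <= 2 ->
  (modulus_convexity V N e <= 0)%E.
Proof.
move=> m1 e2; apply: ereal_inf_lbound.
exists (1 *: u + 0 *: v, 0 *: u + 1 *: v) => /=; first split => //.
- rewrite uvB (N_uvE (c := 2))//; first by rewrite m1 !expr1 sub0r subr0 normrN normr1; lra.
- by apply: N_uvE => //; rewrite m1 !expr1 normr0 normr1 addr0.
- by apply: N_uvE => //; rewrite m1 !expr1 normr0 normr1 add0r.
- rewrite N_half// uvD addr0 add0r (N_uvE (c := 2))//; first by rewrite mulVf ?subrr.
  by rewrite m1 !expr1 normr1; lra.
Qed.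

Lemma modulus_smoothness_ge (e : R) : m = 1%N -> 0 < e ->
  (e%:E <= modulus_smoothness V N e)%E.
Proof.
move=> m1 e0; apply: ereal_sup_ubound.
exists (1 *: u + 0 *: v, 0 *: u + e *: v) => /=; first split => //.
- by apply: N_uvE => //; rewrite m1 !expr1 normr0 normr1 addr0.
- by apply: N_uvE; rewrite ?ltW// m1 !expr1 normr0 add0r gtr0_norm.
- rewrite uvD uvB !addr0 !add0r subr0 !(N_uvE (c := 1 + e)).
  + by congr EFin; field.
  + by lra.
  + by rewrite m1 !expr1 normr1 normrN gtr0_norm.
  + by lra.
  + by rewrite m1 !expr1 normr1 gtr0_norm.
Qed.

Hypothesis m_even : ~~ odd m.
Hypothesis N_hanner : forall x y, V x -> V y -> hanner_le N m x y.

Let norm_even (a : R) : `|a| ^+ m = a ^+ m.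
Proof. by rewrite -normrX ger0_norm// exprn_even_ge0. Qed.

(** For unit vectors Hanner's inequality reads N(x+y)^m + N(x-y)^m <= 2^m. *)
Lemma modulus_convexityE (e : R) : 0 < e <= 2 ->
  modulus_convexity V N e = (1 - (1 - (e / 2) ^+ m) `^ m%:R^-1)%:E.
Proof.
move=> /andP[e0 e2]; set A := _ `^ _.
have e2m : 0 <= 1 - (e / 2) ^+ m.
  by rewrite subr_ge0 exprn_ile1//; lra.
have A0 : 0 <= A by exact: powR_ge0.
have Am : A ^+ m = 1 - (e / 2) ^+ m by exact: powR_invX.
apply/eqP; rewrite eq_le; apply/andP; split.
  apply: ereal_inf_lbound.
  (* Mirror images at distance exactly e, with [A] chosen to make them unit vectors; their midpoint
     A u has norm [A]. *)
  exists (A *: u + (e / 2) *: v, A *: u + (- (e / 2)) *: v) => /=; first split => //.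
  - rewrite uvB subrr (N_uvE (c := e)) ?(ltW e0)//.
    rewrite normr0 expr0n gtn_eqF// add0r norm_even; congr (_ ^+ _); lra.
  - by apply: N_uvE => //; rewrite !norm_even Am expr1n; lra.
  - by apply: N_uvE => //; rewrite normrN !norm_even Am expr1n; lra.
  - rewrite N_half// uvD subrr (N_uvE (c := 2 * A)).
    + by congr (EFin (1 - _)); field.
    + by rewrite mulr_ge0.
    + by rewrite normr0 expr0n gtn_eqF// addr0 norm_even; congr (_ ^+ _); lra.
apply: le_ereal_inf_tmp => _ [[x y] /= [Vx Vy xy Nx Ny] <-].
rewrite lee_fin lerB//.
rewrite -(ler_pXn2r m_gt0) ?nnegrE// Am N_half// exprMn.
have := N_hanner Vx Vy; rewrite /hanner_le Nx Ny subrr expr0n gtn_eqF// addr0.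
have : e ^+ m <= N (x - y) ^+ m by rewrite lerXn2r ?nnegrE ?(ltW e0)//.
rewrite -[1 + 1]/(2 : R) => xy_m H.
have -> : 1 - (e / 2) ^+ m = 2^-1 ^+ m * (2 ^+ m - e ^+ m).
  by rewrite mulrBr -!exprMn mulVf// expr1n [_ * e]mulrC.
by rewrite ler_wpM2l ?exprn_ge0// ?invr_ge0//; lra.
Qed.

Lemma modulus_smoothnessE (e : R) : 0 < e ->
  modulus_smoothness V N e =
  ((2^-1 * ((1 + e) ^+ m + (1 - e) ^+ m)) `^ m%:R^-1 - 1)%:E.
Proof.
move=> e0; set B := _ `^ _.
have S0 : 0 <= 2^-1 * ((1 + e) ^+ m + (1 - e) ^+ m).
  by rewrite mulr_ge0 ?invr_ge0// addr_ge0// exprn_even_ge0.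
have B0 : 0 <= B by exact: powR_ge0.
have Bm : B ^+ m = 2^-1 * ((1 + e) ^+ m + (1 - e) ^+ m) by exact: powR_invX.
apply/eqP; rewrite eq_le; apply/andP; split.
  apply: ge_ereal_sup => _ [[x y] /= [Vx Vy Nx Ny] <-].
  rewrite lee_fin; have := N_hanner Vx Vy; rewrite /hanner_le Nx Ny => H.
  suff : 2^-1 * (N (x + y) + N (x - y)) <= B by lra.
  rewrite -(ler_pXn2r m_gt0) ?nnegrE//; last first.
    by rewrite mulr_ge0 ?invr_ge0// addr_ge0.
  (* The mean of the two norms is at most their power mean, which Hanner's inequality bounds. *)
  rewrite (le_trans (expr_mean_le _ _ _))// Bm.
  by rewrite ler_wpM2l ?invr_ge0.
apply: ereal_sup_ubound; pose c : R := 2^-1 `^ m%:R^-1.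
have c0 : 0 <= c by exact: powR_ge0.
have cm : c ^+ m = 2^-1 by apply: powR_invX => //; rewrite invr_ge0.
(* Here x + y and x - y have the coordinates (1 + e)c and (1 - e)c in opposite orders, hence equal
   norms, so the power mean is attained. *)
exists (c *: u + c *: v, (e * c) *: u + (- (e * c)) *: v) => /=; first split => //.
- by apply: N_uvE => //; rewrite !norm_even cm expr1n; lra.
- apply: N_uvE; first exact: ltW.
  by rewrite normrN !norm_even exprMn cm; lra.
- rewrite uvD uvB !(N_uvE (c := B))//.
  + by congr EFin; field.
  + rewrite !norm_even Bm opprK.
    have -> : c - e * c = (1 - e) * c by ring.
    have -> : c + e * c = (1 + e) * c by ring.
    by rewrite !exprMn cm; ring.
  + rewrite !norm_even Bm.
    have -> : c - e * c = (1 - e) * c by ring.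
    have -> : c + e * c = (1 + e) * c by ring.
    by rewrite !exprMn cm; ring.
Qed.

End moduli.

(** * The sequence space l^m *)

Section lseq_norm.
Context {R : realType} (m : nat).
Hypothesis m_gt0 : (0 < m)%N.
Implicit Types a b : nat -> R.

Let S a := series (fun i => `|a i| ^+ m : R).

Lemma lnorm_ge0 a : 0 <= lnorm m a.
Proof. exact: powR_ge0. Qed.

Lemma lnormE a (l : R) : S a @ \oo --> l -> lnorm m a = l `^ m%:R^-1.
Proof. by move=> al; rewrite /lnorm (cvg_lim _ al). Qed.

Lemma lseqD a b : lseq m a -> lseq m b -> lseq m (a + b).
Proof.
move=> ca cb.
apply: (@series_le_cvg _ _ (fun i => 2 ^+ m * (`|a i| ^+ m + `|b i| ^+ m))).
- by move=> i; exact: exprn_ge0.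
- by move=> i; rewrite mulr_ge0 ?exprn_ge0// addr_ge0 ?exprn_ge0.
- move=> i; apply: (@le_trans _ _ ((`|a i| + `|b i|) ^+ m)).
    by rewrite lerXn2r ?nnegrE ?addr_ge0// ler_normD.
  have := expr_mean_le m (normr_ge0 (a i)) (normr_ge0 (b i)).
  rewrite exprMn exprVn ler_pdivrMl ?exprn_gt0// => /le_trans; apply.
  rewrite ler_wpM2l ?exprn_ge0// ler_piMl ?addr_ge0 ?exprn_ge0//.
  by rewrite invf_le1// ler1n.
- by apply: is_cvg_seriesZ; exact: is_cvg_seriesD.
Qed.

Lemma lseqN b : lseq m b -> lseq m (- b).
Proof.
rewrite /lseq/= (_ : (fun i => `|(- b) i| ^+ m) = (fun i => `|b i| ^+ m))//.
by apply/funext => i; rewrite fctE normrN.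
Qed.

Lemma lnorm_half a : lseq m a -> lnorm m (2^-1 *: a) = 2^-1 * lnorm m a.
Proof.
move=> ca; apply: (exprn_inj m_gt0); rewrite ?mulr_ge0 ?invr_ge0 ?lnorm_ge0//.
have lim_ge0 c : lseq m c -> 0 <= limn (S c).
  move=> cc; apply: limr_ge => //; apply: nearW => k.
  by rewrite /S /series/=; apply: sumr_ge0 => i _; exact: exprn_ge0.
have SZ : S (2^-1 *: a) = 2^-1 ^+ m *: S a.
  apply/funext => k; change (\sum_(0 <= i < k) `|2^-1 * a i| ^+ m =
    2^-1 ^+ m * \sum_(0 <= i < k) `|a i| ^+ m); rewrite mulr_sumr.
  by apply: eq_bigr => i _; rewrite normrM exprMn (@ger0_norm _ 2^-1)// invr_ge0.
have cZ : S (2^-1 *: a) @ \oo --> 2^-1 ^+ m * limn (S a).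
  by rewrite SZ; apply: cvgZr.
rewrite (lnormE cZ) powR_invX//; last by rewrite mulr_ge0 ?exprn_ge0 ?invr_ge0 ?lim_ge0.
by rewrite exprMn powR_invX// lim_ge0.
Qed.

Definition lunit (j : nat) : nat -> R := fun i => (i == j)%:R.

Lemma lunit_series (x y : R) :
  S (x *: lunit 0 + y *: lunit 1) @ \oo --> `|x| ^+ m + `|y| ^+ m.
Proof.
apply: cvg_near_cst; exists 2 => // -[|[|k]]// _.
have E i : (x *: lunit 0 + y *: lunit 1) i = x * (i == 0)%:R + y * (i == 1)%:R by [].
rewrite /S /series/= big_mkord !big_ord_recl/= big1 => [|i _]; last first.
  by rewrite E /bump/= !mulr0 addr0 normr0 expr0n gtn_eqF.
by rewrite !E/= !mulr1 !mulr0 !addr0 add0r.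
Qed.

Lemma lseq_lunit (x y : R) : lseq m (x *: lunit 0 + y *: lunit 1).
Proof. by apply/cvg_ex; eexists; exact: (@lunit_series x y). Qed.

Lemma lnorm_lunit (x y : R) :
  lnorm m (x *: lunit 0 + y *: lunit 1) ^+ m = `|x| ^+ m + `|y| ^+ m.
Proof.
by rewrite (lnormE (@lunit_series x y)) powR_invX// addr_ge0// exprn_ge0.
Qed.

(** Passage to the limit. The inequality for partial sums is a premise because it is obtained from
    the graph norm, in [sum_hanner]. *)
Lemma lnorm_hanner :
  (forall a b k, (series (fun i => `|a i + b i| ^+ m) + series (fun i => `|a i - b i| ^+ m)) k <=
     (S a k `^ m%:R^-1 + S b k `^ m%:R^-1) ^+ m +
     (S a k `^ m%:R^-1 - S b k `^ m%:R^-1) ^+ m) ->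
  forall a b, lseq m a -> lseq m b -> hanner_le (lnorm m) m a b.
Proof.
move=> H a b ca cb.
have lim_ge0 c : lseq m c -> 0 <= limn (S c).
  move=> cc; apply: limr_ge => //; apply: nearW => k.
  by rewrite /S /series/=; apply: sumr_ge0 => i _; exact: exprn_ge0.
have lX c : lseq m c -> lnorm m c ^+ m = limn (S c).
  by move=> cc; rewrite powR_invX// lim_ge0.
have rtcvg c : lseq m c -> S c k `^ m%:R^-1 @[k --> \oo] --> lnorm m c.
  move=> cc; apply: cvg_powR => //; first by rewrite invr_gt0 ltr0n.
  by move=> k; apply: sumr_ge0 => i _; exact: exprn_ge0.
have Xcvg (a_ : R^nat) (l : R) : a_ k @[k --> \oo] --> l ->
    a_ k ^+ m @[k --> \oo] --> l ^+ m.
  by move=> al; apply: (cvg_comp a_ (fun c => c ^+ m) al); exact: exprn_continuous.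
have cD := lseqD ca cb; have cB := lseqD ca (lseqN cb).
rewrite /hanner_le (lX _ cD) (lX _ cB).
have lhs : S (a + b) k + S (a - b) k @[k --> \oo] --> limn (S (a + b)) + limn (S (a - b)).
  by apply: cvgD.
have rhs : (S a k `^ m%:R^-1 + S b k `^ m%:R^-1) ^+ m +
     (S a k `^ m%:R^-1 - S b k `^ m%:R^-1) ^+ m @[k --> \oo] -->
  (lnorm m a + lnorm m b) ^+ m + (lnorm m a - lnorm m b) ^+ m.
  apply: cvgD.
    exact: Xcvg (cvgD (rtcvg _ ca) (rtcvg _ cb)).
  exact: Xcvg (cvgB (rtcvg _ ca) (rtcvg _ cb)).
by apply: (ler_cvg_to lhs rhs); apply: nearW => k; exact: H.
Qed.

End lseq_norm.

(** * Copies of l^m_k among the diagonal kernels *)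

Section embedding.
Context {R : realType} {d : measure_display} {T : measurableType d}.
Variable nu : probability T R.
Hypothesis nu_atomless : atomless nu.
Context {n : nat} (E : rel 'I_n).
Hypothesis E_sym : symmetric E.
Hypothesis E_irr : irreflexive E.
Hypothesis E_norm : seminorming nu E.
Variable v0 : 'I_n.
Let C := component E v0.
Let K := edges_in E C.
Hypothesis K_gt0 : (0 < #|K|)%N.
Hypothesis K_even : ~~ odd #|K|.

Let norm_sum := seminorming_density_norm_sum nu_atomless E_norm.

Let norm_even (a : R) : `|a| ^+ #|K| = a ^+ #|K|.
Proof. by rewrite -normrX ger0_norm// exprn_even_ge0. Qed.

(* Diagonal matrices with equal weights form a copy of l^m_k, so Hanner's
   inequality is inherited from the graph norm. *)
Lemma sum_hanner (a b : nat -> R) k :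
  (series (fun i => `|a i + b i| ^+ #|K|) + series (fun i => `|a i - b i| ^+ #|K|)) k <=
  (series (fun i => `|a i| ^+ #|K|) k `^ #|K|%:R^-1 +
   series (fun i => `|b i| ^+ #|K|) k `^ #|K|%:R^-1) ^+ #|K| +
  (series (fun i => `|a i| ^+ #|K|) k `^ #|K|%:R^-1 -
   series (fun i => `|b i| ^+ #|K|) k `^ #|K|%:R^-1) ^+ #|K|.
Proof.
rewrite fctE /series/= !big_mkord; case: k => [|k].
  by rewrite !big_ord0 addr0 addr_ge0// exprn_even_ge0.
pose p (_ : 'I_k.+1) : R := k.+1%:R^-1.
have p0 i : 0 <= p i by rewrite invr_ge0.
have p1 : \sum_i p i = 1.
  by rewrite sumr_const card_ord -[LHS]mulr_natl mulfV// pnatr_eq0.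
(* Equal weights give every diagonal entry this same factor, which cancels at the end. *)
pose c : R := k.+1%:R^-1 ^+ #|C|.
have c0 : 0 < c by rewrite exprn_gt0// invr_gt0.
pose D (x : 'I_k.+1 -> R) (i j : 'I_k.+1) := if i == j then x i else 0.
have ND x : density_norm (edges E) p (D x) ^+ #|K| = c * \sum_i `|x i| ^+ #|K|.
  transitivity `|\sum_i c * x i ^+ #|K| |; first exact: density_norm_diag.
  rewrite -mulr_sumr normrM (gtr0_norm c0); congr (_ * _).
  under [RHS]eq_bigr do rewrite norm_even.
  by rewrite ger0_norm// sumr_ge0// => i _; rewrite exprn_even_ge0.
pose s := c `^ #|K|%:R^-1.
have NDE x : density_norm (edges E) p (D x) =
    s * (\sum_i `|x i| ^+ #|K|) `^ #|K|%:R^-1.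
  have S0 : 0 <= \sum_i `|x i| ^+ #|K| by apply: sumr_ge0 => i _; exact: exprn_ge0.
  apply: (exprn_inj K_gt0); rewrite ?density_norm_ge0 ?mulr_ge0 ?powR_ge0//.
  by rewrite ND exprMn !powR_invX// ltW.
have DC x i j : D x i j = D x j i by rewrite /D eq_sym; case: eqP => // ->.
have := density_hanner (edges_gt0 K_gt0) norm_sum
  (edges_in_sub E v0) K_gt0 (@edges_inP _ E v0) (@edges_notinP _ E E_sym v0)
  K_even p0 p1 (DC (fun i => a i)) (DC (fun i => b i)).
rewrite (_ : (fun i j => _ + _) = D (fun i => a i + b i)); last first.
  by apply/funext => i; apply/funext => j; rewrite /D; case: eqP; rewrite ?addr0.
rewrite (_ : (fun i j => _ - _) = D (fun i => a i - b i)); last first.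
  by apply/funext => i; apply/funext => j; rewrite /D; case: eqP; rewrite ?subr0.
have sK : s ^+ #|K| = c by exact: powR_invX K_gt0 (ltW c0).
rewrite -/K !ND !NDE -mulrDr -mulrBr -mulrDr !exprMn -mulrDr.
by rewrite sK ler_pM2l.
Qed.

Lemma kernel_space_two_atoms : exists u v : T * T -> R,
  (forall a b : R, kernel_space nu E (a *: u + b *: v)) /\
  (forall a b : R, graph_norm nu E (a *: u + b *: v) ^+ #|K| = `|a| ^+ #|K| + `|b| ^+ #|K|).
Proof.
pose p (_ : bool) : R := 2^-1.
have p0 i : 0 <= p i by rewrite invr_ge0.
have p1 : \sum_i p i = 1 by rewrite big_bool/= /p; lra.
have [f mf nuf] := atomless_partition nu_atomless p0 p1.
(* Normalises the two diagonal blocks: c^m cancels the weight 2^-|C| of a block. *)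
pose c : R := (2 ^+ #|C|) `^ #|K|%:R^-1.
have cK : c ^+ #|K| = 2 ^+ #|C| by apply: powR_invX => //; exact: exprn_ge0.
pose D (x y : R) (i j : bool) := if i == j then (if i then x else y) else 0.
have DC x y i j : D x y i j = D x y j i by rewrite /D eq_sym; case: eqP => // ->.
exists (step_kernel f (D c 0)), (step_kernel f (D 0 c)).
have DE a b : a *: step_kernel f (D c 0) + b *: step_kernel f (D 0 c) =
    step_kernel f (D (a * c) (b * c)).
  apply/funext => z; rewrite /step_kernel !fctE /D.
  by case: eqP => _; first case: (f z.1); rewrite /GRing.scale/= ?mulr0 ?addr0 ?add0r.
split=> a b; rewrite DE; first exact: kernel_space_step.
rewrite (graph_norm_step E mf _ nuf).
have := density_norm_diag E_sym E_irr K_gt0 norm_sum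
  (fun i : bool => if i then a * c else b * c) p0 p1.
rewrite -/K -/C => ->; rewrite big_bool/= /p !norm_even -mulrDr !exprMn cK.
rewrite -mulrDl mulrCA -exprMn mulVf// expr1n mulr1 ger0_norm//.
by rewrite addr_ge0// exprn_even_ge0.
Qed.

End embedding.

(** * Bounds valid for every seminorm, and the conclusion *)

Lemma modulus_convexity_ge0 {R : realType} {U : lmodType R} (V : set U) (N : U -> R) e :
  is_seminorm V N -> (0 <= modulus_convexity V N e)%E.
Proof.
move=> [[_ VD VZ] _ NZ Ntri]; apply: le_ereal_inf_tmp => _ [[x y] /= [Vx Vy _ Nx Ny] <-].
rewrite lee_fin NZ; last exact: VD.
have := Ntri _ _ Vx Vy; rewrite Nx Ny (@ger0_norm _ 2^-1)//; lra.
Qed.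

Lemma modulus_smoothness_le {R : realType} {U : lmodType R} (V : set U) (N : U -> R) e :
  is_seminorm V N -> (modulus_smoothness V N e <= e%:E)%E.
Proof.
move=> [[_ VD VZ] _ NZ Ntri]; apply: ge_ereal_sup => _ [[x y] /= [Vx Vy Nx Ny] <-].
have VNy : V (- y) by rewrite -scaleN1r; exact: VZ.
have NNy : N (- y) = e by rewrite -scaleN1r NZ// normrN1 mul1r.
rewrite lee_fin.
have := Ntri _ _ Vx Vy; have := Ntri _ _ Vx VNy; rewrite Nx Ny NNy; lra.
Qed.

Theorem theorem4p1 (R : realType) (m : nat) (m_gt0 : (0 < m)%N) :
  exists C C' : R, [/\ 0 < C, 0 < C' &
    forall (d : measure_display) (Omega : measurableType d)
      (nu : probability Omega R),
      standard_borel R Omega -> atomless nu ->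
    forall (n : nat) (E : rel 'I_n),
      symmetric E -> irreflexive E ->
      seminorming nu E ->
      (forall v : 'I_n, (1 < #|component E v|)%N ->
         #|edges_in E (component E v)| = m) ->
    let d_H := modulus_convexity (kernel_space nu E) (graph_norm nu E) in
    let s_H := modulus_smoothness (kernel_space nu E) (graph_norm nu E) in
    let d_l := modulus_convexity (@lseq R m) (@lnorm R m) in
    let s_l := modulus_smoothness (@lseq R m) (@lnorm R m) in
    [/\ (forall eps : R, 0 < eps <= 2 -> (C%:E * d_l eps <= d_H eps)%E),
        (forall eps : R, 0 < eps <= 2 -> (1 < m)%N -> (d_H eps <= d_l eps)%E),
        (forall eps : R, 0 < eps -> (1 < m)%N -> (s_l eps <= s_H eps)%E) &
        (forall eps : R, 0 < eps -> (s_H eps <= C'%:E * s_l eps)%E)]].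
Proof.
exists 1, 1; split => // d Omega nu _ nu_atomless n E E_sym E_irr E_norm E_comp.
move=> d_H s_H d_l s_l.
(* Any edge will do: its component is nontrivial and so has exactly [m] edges. *)
have /card_gt0P[e eE] := seminorming_edges_gt0 E_norm.
have [e12 E12] : (e.1 < e.2)%N /\ E e.1 e.2 by move: eE; rewrite inE => /andP.
have Km : #|edges_in E (component E e.1)| = m.
  apply: E_comp; apply/card_gt1P; exists e.1, e.2; split.
  - by rewrite inE connect0.
  - by rewrite inE connect1.
  - by rewrite neq_ltn e12.
have K_gt0 : (0 < #|edges_in E (component E e.1)|)%N by rewrite Km.
have half_l a b : lseq m a -> lseq m b ->
    lnorm m (2^-1 *: (a + b)) = 2^-1 * lnorm m (a + b) :> R.
  by move=> la lb; apply: lnorm_half => //; exact: lseqD.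
have uv_l := @lseq_lunit R m m_gt0; have Nuv_l := @lnorm_lunit R m m_gt0.
have [m_le1|m_gt1] := leqP m 1.
  have m1 : m = 1%N by apply/eqP; rewrite eqn_leq m_le1.
  (* For m = 1 the modulus of convexity of l^1 is at most 0 and that of smoothness at least eps, the
     extreme values for any seminorm; the other two inequalities are stated for m > 1. *)
  split.
  - move=> eps /andP[_ eps2]; rewrite mul1e.
    apply: (@le_trans _ _ 0%E); last exact: modulus_convexity_ge0.
    exact: modulus_convexity_le0 m_gt0 (@lnorm_ge0 R m) half_l _ _ uv_l Nuv_l _ m1 eps2.
  - by [].
  - by [].
  - move=> eps eps0; rewrite mul1e.
    apply: (@le_trans _ _ eps%:E); first exact: modulus_smoothness_le.
    exact: modulus_smoothness_ge m_gt0 (@lnorm_ge0 R m) _ _ uv_l Nuv_l _ m1 eps0.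
have K_even : ~~ odd #|edges_in E (component E e.1)|.
  apply: (component_even E_sym E_irr K_gt0 (R := R)); last by rewrite Km.
  exact: seminorming_density_norm_sum nu_atomless E_norm.
(* Evenness of [m] comes from the existence of the graph, and so does Hanner's inequality in l^m
   below. *)
have m_even : ~~ odd m by rewrite -Km.
have hanner_l : forall a b, lseq m a -> lseq m b -> hanner_le (@lnorm R m) m a b.
  apply: lnorm_hanner => // a b k; rewrite -Km.
  exact: (sum_hanner nu_atomless E_sym E_irr E_norm K_gt0 K_even).
have hanner_H := kernel_space_hanner nu_atomless E_sym E_norm K_gt0 K_even.
have [u [v [V_uv N_uv]]] :=
  kernel_space_two_atoms nu_atomless E_sym E_irr E_norm K_gt0 K_even.
rewrite Km in hanner_H N_uv.
have N_ge0 W : 0 <= graph_norm nu E W by exact: powR_ge0.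
have half_H x y : kernel_space nu E x -> kernel_space nu E y ->
    graph_norm nu E (2^-1 *: (x + y)) = 2^-1 * graph_norm nu E (x + y).
  have [[_ VD _] _ NZ _] := E_norm => Vx Vy.
  by rewrite NZ ?(@ger0_norm _ 2^-1)//; exact: VD.
have dE eps : 0 < eps <= 2 -> d_H eps = d_l eps.
  move=> e2; rewrite /d_H /d_l.
  rewrite (modulus_convexityE m_gt0 N_ge0 half_H V_uv N_uv m_even hanner_H e2).
  by rewrite (modulus_convexityE m_gt0 (@lnorm_ge0 R m) half_l uv_l Nuv_l m_even hanner_l e2).
have sE eps : 0 < eps -> s_H eps = s_l eps.
  move=> e0; rewrite /s_H /s_l.
  rewrite (modulus_smoothnessE m_gt0 N_ge0 V_uv N_uv m_even hanner_H e0).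
  by rewrite (modulus_smoothnessE m_gt0 (@lnorm_ge0 R m) uv_l Nuv_l m_even hanner_l e0).
by split=> eps *; rewrite ?mul1e ?dE ?sE.
Qed.
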